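(* There is a polynomial-time $8$-approximation algorithm for the Demand Pair Selection Problem (DPSP).
   Context: In DPSP one is given two disjoint directed paths $\sigma$ and $\sigma'$, a collection $\mathcal{M}=\{(s_1,t_1),\dots,(s_k,t_k)\}$ of demand pairs with all $s_i\in V(\sigma)$ and all $t_i\in V(\sigma')$ (a vertex may participate in several pairs), and a set $\mathcal{K}$ of constraints. For $v,v'$ on the same path, $v\prec v'$ means $v$ lies strictly before $v'$ on that path, and $v\preceq v'$ means $v\prec v'$ or $v=v'$; for $a\preceq b$ on a path, $(a,b)$ denotes the subpath from $a$ to $b$ inclusive. Two pairs $(a,b),(a',b')$ with $a,a'\in\sigma$, $b,b'\in\sigma'$ cross if $a=a'$, or $b=b'$, or ($a\prec a'$ and $b'\prec b$), or ($a'\prec a$ and $b\prec b'$); a subset of $\mathcal{M}$ is non-crossing if no two distinct pairs in it cross. Each constraint is a quadruple $(i,a,b,w)$ with $i\in\{1,2,3,4\}$, $a,b\in V(\sigma)\cup V(\sigma')$, and integer $1\leq w\leq|\mathcal{M}|$. Type 1: $a,b\in V(\sigma)$, $a\prec b$; a set $\mathcal{M}'$ satisfies it if at most $w$ source vertices of pairs of $\mathcal{M}'$ lie on $(a,b)$. Type 2: $a,b\in V(\sigma')$, $a\prec b$; satisfied if at most $w$ destination vertices of pairs of $\mathcal{M}'$ lie on $(a,b)$. Type 3: $a\in V(\sigma)$, $b\in V(\sigma')$; satisfied if at most $w$ pairs $(s,t)\in\mathcal{M}'$ have $s\preceq a$ and $b\preceq t$. Type 4: $a\in V(\sigma)$,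 $b\in V(\sigma')$; satisfied if at most $w$ pairs $(s,t)\in\mathcal{M}'$ have $a\preceq s$ and $t\preceq b$. The goal is to find a maximum-cardinality non-crossing subset $\mathcal{M}'\subseteq\mathcal{M}$ satisfying all constraints of $\mathcal{K}$. An $8$-approximation returns a feasible solution of cardinality at least $1/8$ of the optimum. *)

(* Defs.v *)
From mathcomp Require Import all_boot.
Set Implicit Arguments. Unset Strict Implicit. Unset Printing Implicit Defensive.

(* DPSP instances.  The vertices of sigma are identified with their      *)
(* positions 0..n-1 along sigma, those of sigma' with 0..m-1, so that     *)
(* v \prec v' on a path is  v < v'.                                       *)
Record dpsp_instance := DPSP {
  len_sigma  : nat;
  len_sigma' : nat;
  demands    : seq (nat * nat);           (* (s_i, t_i), i = 0..k-1        *)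
  constraints : seq (nat * nat * nat * nat) (* (type, a, b, w)            *)
}.

Definition nb_demands (I : dpsp_instance) := size (demands I).

Definition valid_constraint (I : dpsp_instance) (c : nat * nat * nat * nat) :=
  let: (ty, a, b, w) := c in
  [&& 1 <= w, w <= nb_demands I &
   [|| (ty == 1) && (a < b) && (b < len_sigma I),
       (ty == 2) && (a < b) && (b < len_sigma' I),
       (ty == 3) && (a < len_sigma I) && (b < len_sigma' I)
     | (ty == 4) && (a < len_sigma I) && (b < len_sigma' I)]].

Definition valid_instance (I : dpsp_instance) : Prop :=
  all (fun p => (p.1 < len_sigma I) && (p.2 < len_sigma' I)) (demands I)
  /\ all (valid_constraint I) (constraints I).

Definition cross (p q : nat * nat) : bool :=
  [|| p.1 == q.1, p.2 == q.2,
      (p.1 < q.1) && (q.2 < p.2) | (q.1 < p.1) && (p.2 < q.2)].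

(* A sub-collection M' of M is given by a selector on the indices 0..k-1. *)
Definition sel_idx (I : dpsp_instance) (sel : nat -> bool) : seq nat :=
  [seq i <- iota 0 (nb_demands I) | sel i].

Definition sel_pairs (I : dpsp_instance) (sel : nat -> bool) : seq (nat * nat) :=
  [seq nth (0, 0) (demands I) i | i <- sel_idx I sel].

Definition sel_card (I : dpsp_instance) (sel : nat -> bool) : nat :=
  size (sel_idx I sel).

Definition non_crossing (I : dpsp_instance) (sel : nat -> bool) : Prop :=
  forall i j, i \in sel_idx I sel -> j \in sel_idx I sel -> i != j ->
    ~~ cross (nth (0, 0) (demands I) i) (nth (0, 0) (demands I) j).

Definition satisfies (I : dpsp_instance) (sel : nat -> bool)
    (c : nat * nat * nat * nat) : bool :=
  let: (ty, a, b, w) := c in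
  let P := sel_pairs I sel in
  if ty == 1 then
    size (undup [seq p.1 | p <- P & (a <= p.1) && (p.1 <= b)]) <= w
  else if ty == 2 then
    size (undup [seq p.2 | p <- P & (a <= p.2) && (p.2 <= b)]) <= w
  else if ty == 3 then
    count (fun p => (p.1 <= a) && (b <= p.2)) P <= w
  else if ty == 4 then
    count (fun p => (a <= p.1) && (p.2 <= b)) P <= w
  else true.

Definition feasible (I : dpsp_instance) (sel : nat -> bool) : Prop :=
  non_crossing I sel /\ all (satisfies I sel) (constraints I).

Definition input_size (I : dpsp_instance) : nat :=
  len_sigma I + len_sigma' I + nb_demands I + size (constraints I).

(* Machine model: a unit-cost RAM with addition and truncated            *)
(* subtraction only, indirect addressing, and conditional jumps.          *)
(* Memory is nat -> nat; instruction operands are fixed addresses.        *)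
Inductive instr :=
| IConst of nat & nat
| IAdd of nat & nat & nat
| ISub of nat & nat & nat
| ILoad of nat & nat
| IStore of nat & nat
| IJz of nat & nat
| IHalt.

Definition program := seq instr.
Definition memory := nat -> nat.

Definition upd (M : memory) (d v : nat) : memory :=
  fun x => if x == d then v else M x.

(* One step; None means the machine has halted (IHalt or pc out of range). *)
Definition step (P : program) (c : nat * memory) : option (nat * memory) :=
  let: (pc, M) := c in
  match nth IHalt P pc with
  | IConst d k => Some (pc.+1, upd M d k)
  | IAdd d a b => Some (pc.+1, upd M d (M a + M b))
  | ISub d a b => Some (pc.+1, upd M d (M a - M b))
  | ILoad d a => Some (pc.+1, upd M d (M (M a)))
  | IStore a s => Some (pc.+1, upd M (M a) (M s))
  | IJz a t => Some (if M a == 0 then t else pc.+1, M)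
  | IHalt => None
  end.

Fixpoint exec (P : program) (T : nat) (c : nat * memory) : option memory :=
  match step P c with
  | None => Some c.2
  | Some c' => if T is T'.+1 then exec P T' c' else None
  end.

Definition init_mem (w : seq nat) : memory := fun x => nth 0 w x.

Definition encode (I : dpsp_instance) : seq nat :=
  [:: len_sigma I; len_sigma' I; nb_demands I]
  ++ flatten [seq [:: p.1; p.2] | p <- demands I]
  ++ [:: size (constraints I)]
  ++ flatten [seq let: (ty, a, b, w) := c in [:: ty; a; b; w]
             | c <- constraints I].

(* Output convention: after halting, demand pair i (i < k) is selected
   iff memory cell i is nonzero. *)
Definition decode_sel (M : memory) : nat -> bool := fun i => M i != 0.

(* Main.v *)
Require Import Defs.
From mathcomp Require Import all_boot zify.
Set Implicit Arguments. Unset Strict Implicit. Unset Printing Implicit Defensive.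

(** A non-crossing selection is a chain of pairs increasing in both
coordinates, and every constraint region meets a chain in consecutive
elements.  Write [cap p q] for the least [w] of a constraint whose region
contains both [p] and [q] (and [0] if [q] is not above [p]).

Chains of [2 ^ j] demands are built by doubling: a chain [A] from [p] to [r]
and a chain [B] from [x] to [q], both of length [h = 2 ^ j], are joined when
[cap r x >= 5], [cap r q >= 4 h + 1] and [cap p x >= 4 h + 1].  Only the
end points matter, so this is a dynamic program over triples [(j, p, q)].

Soundness: by induction, a region containing the last element of a doubled
chain and [c >= 2] of its elements has [w >= 2 c + 1] (if it reaches into
[A], it contains [r] and [q], and [c <= 2 h]); symmetrically for the first
element.  A region meeting both halves in [c1] and [c2] elements then has
[w >= c1 + c2].

Completeness: if the optimum has [n] elements, any [2 ^ j] of them at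
consecutive distance 4 pass all the tests, so a chain of length [2 ^ j] is
found whenever [4 (2 ^ j - 1) < n].  Hence the largest [j] with a nonempty
table satisfies [n <= 4 (2 ^ (j + 1) - 1) < 8 * 2 ^ j]. *)

(** * Doubled chains *)

Definition ltp (p q : nat * nat) := (p.1 < q.1) && (p.2 < q.2).
Definition lep (p q : nat * nat) := (p.1 <= q.1) && (p.2 <= q.2).

Definition inreg (c : nat * nat * nat * nat) (p : nat * nat) : bool :=
  let: (ty, a, b, _) := c in
  [|| [&& ty == 1, a <= p.1 & p.1 <= b],
      [&& ty == 2, a <= p.2 & p.2 <= b],
      [&& ty == 3, p.1 <= a & b <= p.2]
    | [&& ty == 4, a <= p.1 & p.2 <= b]].

(* For [ltp p q]: the region of [c] contains both [p] and [q]. *)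
Definition spans (c : nat * nat * nat * nat) (p q : nat * nat) : bool :=
  let: (ty, a, b, _) := c in
  [|| [&& ty == 1, a <= p.1 & q.1 <= b],
      [&& ty == 2, a <= p.2 & q.2 <= b],
      [&& ty == 3, q.1 <= a & b <= p.2]
    | [&& ty == 4, a <= p.1 & q.2 <= b]].

Lemma inreg_spans c p q : inreg c p -> inreg c q -> spans c p q.
Proof. by case: c => [[[ty a] b] w]; rewrite /inreg /spans; lia. Qed.

Lemma spans_inreg c p m q : lep p m -> lep m q -> spans c p q -> inreg c m.
Proof. by case: c => [[[ty a] b] w]; rewrite /inreg /spans /lep; lia. Qed.

Lemma inreg_convex c p m q :
  lep p m -> lep m q -> inreg c p -> inreg c q -> inreg c m.
Proof.
by move=> h1 h2 hp hq; apply: spans_inreg h1 h2 _; apply: inreg_spans.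
Qed.

Lemma ltp_lep p q : ltp p q -> lep p q.
Proof. by rewrite /ltp /lep; lia. Qed.

Definition clip p q w (c : nat * nat * nat * nat) :=
  if spans c p q then minn w c.2 else w.

(** The start value [nb_demands I] plays the role of infinity, as no selection is larger. The start
    value 0 makes every positive threshold force [ltp p q], so that one comparison tests order and
    capacity together. *)
Definition capacity (I : dpsp_instance) p q :=
  foldl (clip p q) (if ltp p q then nb_demands I else 0) (constraints I).

Lemma leq_capacity I p q h :
  (h <= capacity I p q) = (h <= if ltp p q then nb_demands I else 0)
    && all (fun c => spans c p q ==> (h <= c.2)) (constraints I).
Proof.
rewrite /capacity; move: (if _ then _ else _) => w.
elim: (constraints I) w => [|c cs IH] w /=; first by rewrite andbT.
by rewrite IH /clip; case: spans; rewrite //= leq_min andbA.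
Qed.

Section Instance.

Variable I : dpsp_instance.
Let k := nb_demands I.
Let dem i := nth (0, 0) (demands I) i.
Let cap i j := capacity I (dem i) (dem j).

Lemma capacity_ltp h p q : h < capacity I p q -> ltp p q.
Proof. by rewrite leq_capacity; case: ltp. Qed.

(** All tests speak of end points, which is why a table indexed by [p] and [q] suffices. The bound
    [4 * 2 ^ j' + 1] is one more than twice the length of the joined chain. *)
Fixpoint good j p q (l : seq nat) : Prop :=
  if j is j'.+1 then
    exists r x l1 l2, [/\ good j' p r l1, good j' x q l2, l = l1 ++ l2
      & [/\ 5 <= cap r x, 4 * 2 ^ j' + 1 <= cap r q
          & 4 * 2 ^ j' + 1 <= cap p x]]
  else [/\ p = q, l = [:: p] & p < k].

Lemma good_size j p q l : good j p q l -> size l = 2 ^ j.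
Proof.
elim: j p q l => [|j IH] p q l /=; first by case=> _ ->.
case=> r [x [l1 [l2 [g1 g2 -> _]]]].
by rewrite size_cat (IH _ _ _ g1) (IH _ _ _ g2) expnS mul2n addnn.
Qed.

Lemma good_bound j p q l : good j p q l -> all (fun i => i < k) l.
Proof.
elim: j p q l => [|j IH] p q l /=; first by case=> _ -> h; rewrite /= h.
case=> r [x [l1 [l2 [g1 g2 -> _]]]].
by rewrite all_cat (IH _ _ _ g1) (IH _ _ _ g2).
Qed.

Lemma good_ends j p q l : good j p q l ->
  [/\ p \in l, q \in l, {in l, forall i, lep (dem p) (dem i)}
    & {in l, forall i, lep (dem i) (dem q)}].
Proof.
have lepp p' : lep p' p' by rewrite /lep !leqnn.
have lept a b c : lep a b -> lep b c -> lep a c by rewrite /lep; lia.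
elim: j p q l => [|j IH] p q l /=.
  case=> -> -> _; split; rewrite ?mem_head // => i;
  by rewrite inE => /eqP ->.
case=> r [x [l1 [l2 [/IH [p1 q1 le1 ge1] /IH [p2 q2 le2 ge2] -> [h _ _]]]]].
have rx := ltp_lep (capacity_ltp h).
split; rewrite ?mem_cat ?p1 ?q2 ?orbT // => i; rewrite mem_cat => /orP [] hi.
- exact: le1.
- exact: lept (le1 _ q1) (lept _ _ _ rx (le2 _ hi)).
- exact: lept (lept _ _ _ (ge1 _ hi) rx) (ge2 _ p2).
- exact: ge2.
Qed.

Lemma good_pairwise j p q l :
  good j p q l -> pairwise (fun i i' => ltp (dem i) (dem i')) l.
Proof.
elim: j p q l => [|j IH] p q l /=; first by case=> _ -> _.
case=> r [x [l1 [l2 [g1 g2 -> [h _ _]]]]].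
rewrite pairwise_cat (IH _ _ _ g1) (IH _ _ _ g2) !andbT.
have [_ _ _ ge1] := good_ends g1; have [_ _ le2 _] := good_ends g2.
have rx := capacity_ltp h; apply/allrelP => i i' hi hi'.
by move: rx (ge1 _ hi) (le2 _ hi'); rewrite /ltp /lep; lia.
Qed.

Lemma good_uniq j p q l : good j p q l -> uniq l.
Proof.
move/good_pairwise; apply: pairwise_uniq => i.
by rewrite /ltp ltnn.
Qed.

Lemma spans_capacity c h p q : c \in constraints I ->
  spans c p q -> h <= capacity I p q -> h <= c.2.
Proof. by move=> hc hs; rewrite leq_capacity => /andP [_ /allP /(_ _ hc)]; rewrite hs. Qed.

(** The factor 2 is the slack that later allows the counts of two halves to be added. A single
    element is excluded because its constraint may have bound 1. *)
Lemma good_suffix c j p q l : c \in constraints I -> good j p q l ->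
  inreg c (dem q) -> 1 < count (inreg c \o dem) l ->
  2 * count (inreg c \o dem) l + 1 <= c.2.
Proof.
move=> hc; elim: j p q l => [|j IH] p q l /=.
  by case=> -> -> _ /=; rewrite addn0; case: (inreg _ _).
case=> r [x [l1 [l2 [g1 g2 -> [h1 h2 h3]]]]] hq.
(* If the region misses [l1], only [l2] counts, and [q] is the last element of [l2] too. *)
rewrite count_cat; have [|] := boolP (has (inreg c \o dem) l1); last first.
  by rewrite has_count -eqn0Ngt => /eqP ->; apply: IH g2 hq.
case/hasP=> i hi hR _.
have [p1 r1 le1 ge1] := good_ends g1; have [x2 q2 le2 ge2] := good_ends g2.
have rx := ltp_lep (capacity_ltp h1).
have rq : lep (dem r) (dem q) by move: rx (ge2 _ x2); rewrite /lep; lia.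
(* Otherwise convexity puts [r] into the region, and the test from [r] to [q] covers even a region
   that contains the whole joined chain. *)
have hr := inreg_convex (ge1 _ hi) rq hR hq.
have := spans_capacity hc (inreg_spans hr hq) h2.
have := count_size (inreg c \o dem) l1; have := count_size (inreg c \o dem) l2.
rewrite (good_size g1) (good_size g2).
move: (2 ^ j) (count _ l1) (count _ l2) c.2 => y a b w; clear; lia.
Qed.

(** Mirror image of [good_suffix], with the test from [p] to [x] in place of the one from [r] to
    [q]. *)
Lemma good_prefix c j p q l : c \in constraints I -> good j p q l ->
  inreg c (dem p) -> 1 < count (inreg c \o dem) l ->
  2 * count (inreg c \o dem) l + 1 <= c.2.
Proof.
move=> hc; elim: j p q l => [|j IH] p q l /=.
  by case=> -> -> _ /=; rewrite addn0; case: (inreg _ _).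
case=> r [x [l1 [l2 [g1 g2 -> [h1 h2 h3]]]]] hp.
rewrite count_cat; have [|] := boolP (has (inreg c \o dem) l2); last first.
  by rewrite has_count -eqn0Ngt => /eqP ->; rewrite addn0; apply: IH g1 hp.
case/hasP=> i hi hR _.
have [p1 r1 le1 ge1] := good_ends g1; have [x2 q2 le2 ge2] := good_ends g2.
have rx := ltp_lep (capacity_ltp h1).
have px : lep (dem p) (dem x) by move: rx (ge1 _ p1); rewrite /lep; lia.
have hx := inreg_convex px (le2 _ hi) hp hR.
have := spans_capacity hc (inreg_spans hp hx) h3.
have := count_size (inreg c \o dem) l1; have := count_size (inreg c \o dem) l2.
rewrite (good_size g1) (good_size g2).
move: (2 ^ j) (count _ l1) (count _ l2) c.2 => y a b w; clear; lia.
Qed.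

(** A region inside one half is covered by induction. By convexity, one that meets both halves
    contains [r] and [x], so it falls under [good_suffix] on the left and [good_prefix] on the
    right. *)
Lemma good_count c j p q l : c \in constraints I -> 0 < c.2 ->
  good j p q l -> count (inreg c \o dem) l <= c.2.
Proof.
move=> hc c0; elim: j p q l => [|j IH] p q l /=.
  by case=> _ -> _ /=; rewrite addn0; apply: leq_trans c0; apply: leq_b1.
case=> r [x [l1 [l2 [g1 g2 -> [h1 h2 h3]]]]]; rewrite count_cat.
have [|] := boolP (has (inreg c \o dem) l1); last first.
  by rewrite has_count -eqn0Ngt => /eqP ->; apply: IH g2.
have [|] := boolP (has (inreg c \o dem) l2); last first.
  by rewrite has_count -eqn0Ngt => /eqP -> _; rewrite addn0; apply: IH g1.
move=> has2 has1; have := has1; have := has2; rewrite !has_count.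
case/hasP: has2 => i2 hi2 R2; case/hasP: has1 => i1 hi1 R1.
have [p1 r1 le1 ge1] := good_ends g1; have [x2 q2 le2 ge2] := good_ends g2.
have rx := ltp_lep (capacity_ltp h1).
have hr : inreg c (dem r).
  apply: inreg_convex (ge1 _ hi1) _ R1 R2.
  by move: rx (le2 _ hi2); rewrite /lep; lia.
have hx : inreg c (dem x).
  apply: inreg_convex _ (le2 _ hi2) R1 R2.
  by move: rx (ge1 _ hi1); rewrite /lep; lia.
(* A half met at least twice takes less than half of the bound, and a half met once takes 1. If both
   are met once, the bound 5 between [r] and [x] suffices. *)
have := spans_capacity hc (inreg_spans hr hx) h1.
have := good_suffix hc g1 hr; have := good_prefix hc g2 hx.
move: (count _ l1) (count _ l2) c.2 => a b w; clear; lia.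
Qed.

(** Types 1 and 2 count distinct end points, which are never more numerous than the pairs. *)
Lemma count_satisfies sel c :
  count (inreg c \o dem) (sel_idx I sel) <= c.2 -> satisfies I sel c.
Proof.
rewrite -(count_map dem) -/(sel_pairs I sel).
case: c => [[[ty a] b] w] /= hw; rewrite /satisfies.
case: eqP hw => [-> hw|n1].
  apply: leq_trans (size_undup _) _; rewrite size_map size_filter.
  by apply: leq_trans hw; apply: sub_count => p; rewrite /inreg /=; lia.
case: eqP => [-> hw|n2].
  apply: leq_trans (size_undup _) _; rewrite size_map size_filter.
  by apply: leq_trans hw; apply: sub_count => p; rewrite /inreg /=; lia.
case: eqP => [-> hw|n3].
  by apply: leq_trans hw; apply: sub_count => p; rewrite /inreg /=; lia.
case: eqP => [-> hw|//].
by apply: leq_trans hw; apply: sub_count => p; rewrite /inreg /=; lia.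
Qed.

Lemma noncross_coord_inj sel (f : nat * nat -> nat) :
  (forall p q, f p = f q -> cross p q) ->
  non_crossing I sel -> {in sel_idx I sel &, injective (f \o dem)}.
Proof.
move=> hf nc i j hi hj /= E; apply/eqP/negPn/negP => ne.
by have := nc _ _ hi hj ne; rewrite hf.
Qed.

(** Pairs of a non-crossing selection share no end point, so for types 1 and 2 counting vertices
    amounts to counting pairs. *)
Lemma satisfies_count sel c : non_crossing I sel -> satisfies I sel c ->
  count (inreg c \o dem) (sel_idx I sel) <= c.2.
Proof.
move=> nc; rewrite -(count_map dem) -/(sel_pairs I sel).
have uq (f : nat * nat -> nat) (P : pred (nat * nat)) : (forall p q, f p = f q -> cross p q) ->
    uniq [seq f p | p <- sel_pairs I sel & P p].
  move=> hf; apply: (subseq_uniq (map_subseq f (filter_subseq P _))).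
  rewrite -map_comp (map_inj_in_uniq (noncross_coord_inj hf nc)).
  by rewrite filter_uniq // iota_uniq.
have u1 P : uniq [seq p.1 | p <- sel_pairs I sel & P p].
  by apply: uq => p q /eqP E; rewrite /cross E.
have u2 P : uniq [seq p.2 | p <- sel_pairs I sel & P p].
  by apply: uq => p q /eqP E; rewrite /cross E orbT.
case: c => [[[ty a] b] w]; rewrite /satisfies.
case: eqP => [->|n1].
  rewrite undup_id // size_map size_filter; apply: leq_trans.
  by apply: sub_count => p; rewrite /inreg; lia.
case: eqP => [->|n2].
  rewrite undup_id // size_map size_filter; apply: leq_trans.
  by apply: sub_count => p; rewrite /inreg; lia.
case: eqP => [->|n3].
  by apply: leq_trans; apply: sub_count => p; rewrite /inreg; lia.
case: eqP => [->|n4].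
  by apply: leq_trans; apply: sub_count => p; rewrite /inreg; lia.
(* A constraint of any other type has an empty region. *)
move=> _; rewrite (eq_count (a2 := pred0)) ?count_pred0 //.
by move=> p; rewrite /inreg /=; lia.
Qed.

(** The selector is prescribed below [k] only, because the remaining memory cells are arbitrary when
    the machine halts. *)
Lemma good_feasible j p q l sel : valid_instance I -> good j p q l ->
  (forall i, i < k -> sel i = (i \in l)) ->
  feasible I sel /\ sel_card I sel = 2 ^ j.
Proof.
case=> _ /allP vc g hs.
have pl : perm_eq (sel_idx I sel) l.
  apply: uniq_perm; rewrite ?filter_uniq ?iota_uniq //; first exact: good_uniq g.
  move=> i; rewrite mem_filter mem_iota add0n /=.
  have [hi|hi] := ltnP i (nb_demands I); first by rewrite hs // andbT.
  rewrite andbF; apply/esym/negP => /(allP (good_bound g)).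
  by rewrite /k; lia.
split; last by rewrite /sel_card (perm_size pl) (good_size g).
split; last first.
  apply/allP => c hc; apply: count_satisfies.
  rewrite (permP pl); apply: good_count g => //.
  by have := vc _ hc; case: c {hc} => [[[ty a] b] w] /= /and3P [].
move=> i i'; rewrite !(perm_mem pl) => hi hi' ne.
(* Positions in the chain decide which of two selected pairs is the lower one. *)
have /pairwiseP - /(_ 0) pw := good_pairwise g.
have := pw (index i l) (index i' l); have := pw (index i' l) (index i l).
rewrite !inE !index_mem hi hi' !nth_index // => /(_ isT isT) H1 /(_ isT isT) H2.
rewrite /cross -/(dem i) -/(dem i').
have [lt|lt|E] := ltngtP (index i l) (index i' l).
- by have := H2 lt; rewrite /ltp; lia.
- by have := H1 lt; rewrite /ltp; lia.
by case/negP: ne; rewrite -(nth_index 0 hi) E nth_index.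
Qed.

(** * Chains inside an arbitrary feasible selection *)

Section Optimum.

Variable sel : nat -> bool.
Hypothesis fs : feasible I sel.

(** Sorting by source sorts the destinations as well: of two distinct pairs that do not cross, one
    is strictly below the other in both coordinates. *)
Let o := sort (fun i j => (dem i).1 <= (dem j).1) (sel_idx I sel).
Let n := sel_card I sel.

Lemma opt_size : size o = n.
Proof. by rewrite size_sort. Qed.

Lemma opt_mem : o =i sel_idx I sel.
Proof. exact: mem_sort. Qed.

Lemma opt_le_demands : n <= k.
Proof. by rewrite /n /sel_card size_filter; apply: leq_trans (count_size _ _) _; rewrite size_iota. Qed.

Lemma opt_ltp u v : u < v -> v < n -> ltp (dem (nth 0 o u)) (dem (nth 0 o v)).
Proof.
move=> uv vn; have [nc _] := fs.
have un := ltn_trans uv vn.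
have so : sorted (fun i j => (dem i).1 <= (dem j).1) o.
  by apply: sort_sorted => i j; apply: leq_total.
have le : (dem (nth 0 o u)).1 <= (dem (nth 0 o v)).1.
  apply: (sorted_leq_nth _ _ 0 so); rewrite ?inE ?opt_size //.
  - by move=> a b c; apply: leq_trans.
  - exact: ltnW.
have uo : uniq o by rewrite sort_uniq filter_uniq // iota_uniq.
have ne : nth 0 o u != nth 0 o v by rewrite nth_uniq ?opt_size //; lia.
have mu : nth 0 o u \in sel_idx I sel by rewrite -opt_mem mem_nth ?opt_size.
have mv : nth 0 o v \in sel_idx I sel by rewrite -opt_mem mem_nth ?opt_size.
have := nc _ _ mu mv ne; rewrite /cross -/(dem _) -/(dem _).
by move: le; rewrite /ltp -/(dem _); lia.
Qed.

(** A region that spans the elements at positions [u] and [v] contains all [v - u + 1] elements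
    between them, and the selection obeys its bound. *)
Lemma opt_capacity u v : u < v -> v < n ->
  v - u + 1 <= cap (nth 0 o u) (nth 0 o v).
Proof.
move=> uv vn; rewrite /cap leq_capacity opt_ltp //.
apply/andP; split; first by have := opt_le_demands; rewrite /k; lia.
apply/allP => c hc; apply/implyP => sp.
have [nc /allP /(_ _ hc) sc] := fs.
apply: leq_trans (satisfies_count nc sc).
have -> : count (inreg c \o dem) (sel_idx I sel) = count (inreg c \o dem) o.
  by apply/permP; rewrite perm_sym /o perm_sort.
(* Cut [o] before position [u] and after position [v]; the middle window [m] lies entirely in the
   region. *)
rewrite -(cat_take_drop u o) count_cat -(cat_take_drop (v - u + 1) (drop u o)).
rewrite count_cat; set m := take (v - u + 1) _.
have sm : size m = v - u + 1.
  by rewrite /m size_takel ?size_drop ?opt_size //; lia.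
have : all (inreg c \o dem) m.
  apply/(all_nthP 0) => i; rewrite sm => hi.
  rewrite /m nth_take // nth_drop /=.
  have le1 : lep (dem (nth 0 o u)) (dem (nth 0 o (u + i))).
    have [->|i0] := posnP i; first by rewrite addn0 /lep !leqnn.
    by apply/ltp_lep/opt_ltp; lia.
  have le2 : lep (dem (nth 0 o (u + i))) (dem (nth 0 o v)).
    have [<-|ne] := eqVneq (u + i) v; first by rewrite /lep !leqnn.
    by apply/ltp_lep/opt_ltp; lia.
  exact: spans_inreg le1 le2 sp.
by rewrite all_count sm => /eqP ->; lia.
Qed.

(** The chain takes every fourth element of [o], starting at position [a]. *)
Lemma opt_good j a : a + 4 * (2 ^ j - 1) < n ->
  exists l, good j (nth 0 o a) (nth 0 o (a + 4 * (2 ^ j - 1))) l.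
Proof.
elim: j a => [|j IH] a /=.
  rewrite subnn muln0 addn0 => ha; exists [:: nth 0 o a]; split=> //.
  have : nth 0 o a \in sel_idx I sel by rewrite -opt_mem mem_nth ?opt_size.
  by rewrite mem_filter mem_iota /k; lia.
have h1 : 0 < 2 ^ j by rewrite expn_gt0.
rewrite expnS => ha.
have [|l1 g1] := IH a; first by lia.
have [|l2 g2] := IH (a + 4 * 2 ^ j); first by lia.
exists (l1 ++ l2), (nth 0 o (a + 4 * (2 ^ j - 1))), (nth 0 o (a + 4 * 2 ^ j)), l1, l2.
have E : a + 4 * (2 * 2 ^ j - 1) = a + 4 * 2 ^ j + 4 * (2 ^ j - 1) by lia.
rewrite E; split=> //; split.
(* The three position gaps are 4, [4 * 2 ^ j] and [4 * 2 ^ j]; a gap [g] gives capacity at least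
   [g + 1], which is exactly each threshold. *)
- by apply: leq_trans (opt_capacity _ _); lia.
- by apply: leq_trans (opt_capacity _ _); lia.
- by apply: leq_trans (opt_capacity _ _); lia.
Qed.

(** If [n] exceeded [8 * 2 ^ J], then [4 * (2 ^ J.+1 - 1) < n], and [opt_good] would produce a chain
    one level above [J]. *)
Lemma opt_bound J : 
  (forall j p q l, j <= k -> good j p q l -> j <= J) -> n <= 8 * 2 ^ J.
Proof.
move=> mx; rewrite leqNgt; apply/negP => ltn.
have p0 : 0 < 2 ^ J by rewrite expn_gt0.
have [|l g] := @opt_good J.+1 0; first by rewrite expnS; lia.
have := mx _ _ _ _ _ g; rewrite ltnn; move=> /(_ _)/negP; apply=> //.
(* Level [J.+1] is within the range [k] of the hypothesis, since [J < 2 ^ J] and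
   [8 * 2 ^ J < n <= k]. *)
have := opt_le_demands; have := ltn_expl J (isT : 1 < 2); lia.
Qed.

End Optimum.

End Instance.

(** * A structured language and its compilation to the RAM *)

Inductive expr :=
| Cst of nat
| Var of nat
| Plus of expr & expr
| Minus of expr & expr
| Get of nat & expr.

Inductive cmd :=
| Skip
| Asg of nat & expr
| Put of nat & expr & expr
| Seq of cmd & cmd
| If of expr & cmd & cmd
| Repeat of nat & cmd.

Record state := State { vr : nat -> nat; ar : nat -> nat -> nat }.

Definition setv (st : state) x v :=
  State (fun y => if y == x then v else vr st y) (ar st).

Definition seta (st : state) A i v :=
  State (vr st)
    (fun A' i' => if (A' == A) && (i' == i) then v else ar st A' i').

Fixpoint eval (e : expr) (st : state) : nat :=
  match e with
  | Cst n => n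
  | Var x => vr st x
  | Plus a b => eval a st + eval b st
  | Minus a b => eval a st - eval b st
  | Get A a => ar st A (eval a st)
  end.

Fixpoint run (c : cmd) (st : state) : state :=
  match c with
  | Skip => st
  | Asg x e => setv st x (eval e st)
  | Put A e1 e2 => seta st A (eval e1 st) (eval e2 st)
  | Seq a b => run b (run a st)
  | If e a b => if eval e st != 0 then run a st else run b st
  | Repeat x b => iter (vr st x) (run b) st
  end.

Fixpoint ecost (e : expr) : nat :=
  match e with
  | Cst _ => 1
  | Var _ => 2
  | Plus a b | Minus a b => ecost a + ecost b + 1
  | Get _ a => ecost a + 18
  end.

(** The constants count compiled instructions: 17 for an address and 1 for the access make 18; a
    loop has 2 instructions of set-up and a final test, and each pass adds a test and 4
    instructions. *)
Fixpoint cost (c : cmd) (st : state) : nat :=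
  match c with
  | Skip => 0
  | Asg _ e => ecost e + 2
  | Put _ e1 e2 => ecost e1 + ecost e2 + 18
  | Seq a b => cost a st + cost b (run a st)
  | If e a b =>
      ecost e + 3 + (if eval e st != 0 then cost a st else cost b st)
  | Repeat x b => 3 + \sum_(i < vr st x) (cost b (iter i (run b) st) + 5)
  end.

(* Cell 0 holds the base [B] of the heap, cells 1 and 2 are scratch; the other
   cells below [nreg] are, interleaved modulo 3, expression temporaries, loop
   counters (indexed by nesting depth) and program variables. *)
Definition nreg := 98.
Definition tmpa d := 3 + 3 * d.
Definition cnta d := 4 + 3 * d.
Definition vara x := 5 + 3 * x.

(* Eight unbounded arrays are interleaved above [B].  Array 0 is the input and
   output word: its cells between [nreg] and [B] stay in place, only those that
   clash with the registers are relocated. *)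
Definition addr B A y :=
  if (A == 0) && (nreg <= y < B) then y else B + 8 * y + A.

(** Here [y] is the cell holding the index. Cell 1 receives a sum of truncated subtractions that is
    0 exactly when the index stays in place; the jump then leaves the index itself in cell 2.
    Otherwise three doublings produce the factor 8. *)
Definition addr_code pc A y :=
  [:: IConst 1 nreg; ISub 1 1 y; IConst 2 1; IAdd 2 y 2; ISub 2 2 0;
      IAdd 1 1 2; IConst 2 A; IAdd 1 1 2; IConst 2 0; IAdd 2 y 2;
      IJz 1 (pc + 17); IAdd 2 2 2; IAdd 2 2 2; IAdd 2 2 2; IAdd 2 2 0;
      IConst 1 A; IAdd 2 2 1].

Fixpoint cexpr pc d e : program :=
  match e with
  | Cst n => [:: IConst (tmpa d) n]
  | Var x => [:: IConst (tmpa d) 0; IAdd (tmpa d) (vara x) (tmpa d)]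
  | Plus a b =>
      let ca := cexpr pc d a in
      ca ++ cexpr (pc + size ca) d.+1 b
         ++ [:: IAdd (tmpa d) (tmpa d) (tmpa d.+1)]
  | Minus a b =>
      let ca := cexpr pc d a in
      ca ++ cexpr (pc + size ca) d.+1 b
         ++ [:: ISub (tmpa d) (tmpa d) (tmpa d.+1)]
  | Get A a =>
      let ca := cexpr pc d a in
      ca ++ addr_code (pc + size ca) A (tmpa d) ++ [:: ILoad (tmpa d) 2]
  end.

(** Jump targets are absolute, hence the argument [pc]. An unconditional jump clears cell 1 and then
    tests it. The loop counter at depth [d] runs down from the value copied on entry. *)
Fixpoint ccmd pc d c : program :=
  match c with
  | Skip => [::]
  | Asg x e =>
      cexpr pc 0 e ++ [:: IConst 1 0; IAdd (vara x) (tmpa 0) 1]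
  | Put A e1 e2 =>
      let c1 := cexpr pc 0 e1 in
      let c2 := cexpr (pc + size c1) 1 e2 in
      c1 ++ c2 ++ addr_code (pc + size c1 + size c2) A (tmpa 0)
         ++ [:: IStore 2 (tmpa 1)]
  | Seq a b =>
      let ca := ccmd pc d a in ca ++ ccmd (pc + size ca) d b
  | If e a b =>
      let ce := cexpr pc 0 e in
      let ca := ccmd (pc + size ce).+1 d a in
      let pb := pc + size ce + 1 + size ca + 2 in
      let cb := ccmd pb d b in
      ce ++ [:: IJz (tmpa 0) pb] ++ ca
         ++ [:: IConst 1 0; IJz 1 (pb + size cb)] ++ cb
  | Repeat x b =>
      let cb := ccmd (pc + 3) d.+1 b in
      [:: IConst 1 0; IAdd (cnta d) (vara x) 1;
          IJz (cnta d) (pc + size cb + 7)]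
      ++ cb
      ++ [:: IConst 1 1; ISub (cnta d) (cnta d) 1; IConst 1 0; IJz 1 (pc + 2)]
  end.

Fixpoint wfe d e : bool :=
  (tmpa d < nreg) &&
  match e with
  | Cst _ => true
  | Var x => vara x < nreg
  | Plus a b | Minus a b => wfe d a && wfe d.+1 b
  | Get A a => (A < 8) && wfe d a
  end.

Fixpoint wfc d c : bool :=
  match c with
  | Skip => true
  | Asg x e => (vara x < nreg) && wfe 0 e
  | Put A e1 e2 => [&& A < 8, wfe 0 e1 & wfe 1 e2]
  | Seq a b => wfc d a && wfc d b
  | If e a b => [&& wfe 0 e, wfc d a & wfc d b]
  | Repeat x b => [&& vara x < nreg, cnta d < nreg & wfc d.+1 b]
  end.

(** * Partial runs and correctness of the compiled code *)

Fixpoint nsteps (P : program) t c : option (nat * memory) :=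
  if t is t'.+1 then
    if step P c is Some c' then nsteps P t' c' else None
  else Some c.

Definition code_at (P : program) pc code :=
  forall i, i < size code -> nth IHalt P (pc + i) = nth IHalt code i.

Lemma nsteps_trans P t1 t2 c1 c2 c3 :
  nsteps P t1 c1 = Some c2 -> nsteps P t2 c2 = Some c3 ->
  nsteps P (t1 + t2) c1 = Some c3.
Proof.
elim: t1 c1 => [|t1 IH] c1 /=; first by case=> ->.
by case: (step P c1) => // c' h1 h2; apply: IH.
Qed.

Lemma exec_nsteps P t c c' :
  nsteps P t c = Some c' -> step P c' = None -> exec P t c = Some c'.2.
Proof.
elim: t c => [|t IH] c /=; first by case=> -> ->.
by case: (step P c) => // c1 h1 h2; apply: IH.
Qed.

Lemma code_at_cat P pc a b :
  code_at P pc (a ++ b) -> code_at P pc a /\ code_at P (pc + size a) b.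
Proof.
move=> H; split=> i Hi.
  by rewrite H ?size_cat ?nth_cat ?Hi //; lia.
rewrite -addnA H ?size_cat ?nth_cat; last by lia.
by rewrite ltnNge leq_addr /= addKn.
Qed.

Lemma code_at_cons P pc x s :
  code_at P pc (x :: s) -> nth IHalt P pc = x /\ code_at P pc.+1 s.
Proof.
move=> H; split; first by have := H 0; rewrite addn0; apply.
by move=> i Hi; have := H i.+1 Hi; rewrite addnS addSn.
Qed.

Definition straight (i : instr) : bool :=
  match i with IJz _ _ | IHalt => false | _ => true end.

Definition exec1 (M : memory) (i : instr) : memory :=
  match i with
  | IConst d k => upd M d k
  | IAdd d a b => upd M d (M a + M b)
  | ISub d a b => upd M d (M a - M b)
  | ILoad d a => upd M d (M (M a))
  | IStore a s => upd M (M a) (M s)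
  | _ => M
  end.

Lemma nsteps_straight P pc code M :
  code_at P pc code -> all straight code ->
  nsteps P (size code) (pc, M) = Some (pc + size code, foldl exec1 M code).
Proof.
elim: code pc M => [|i code IH] pc M /=; first by rewrite addn0.
case/code_at_cons=> hn hr /andP [hi hc]; rewrite hn.
by case: i hi hn => //= *; rewrite IH // addSnnS.
Qed.

Lemma nsteps_jz P pc a t M : nth IHalt P pc = IJz a t ->
  nsteps P 1 (pc, M) = Some (if M a == 0 then t else pc.+1, M).
Proof. by rewrite /= => ->. Qed.

Arguments nsteps : simpl never.

(** These are the cells that evaluating an expression at depth [d] may destroy. Temporaries are the
    multiples of 3, so counters and variables are never among them. *)
Definition scratch d a :=
  [|| a == 1, a == 2 | [&& a < nreg, a %% 3 == 0 & tmpa d <= a]].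

Definition agree d (M M' : memory) := forall a, ~~ scratch d a -> M' a = M a.

Lemma agree_trans d M1 M2 M3 : agree d M1 M2 -> agree d M2 M3 -> agree d M1 M3.
Proof. by move=> h1 h2 a ha; rewrite h2 // h1. Qed.

Lemma agree_weak d d' M M' : d <= d' -> agree d' M M' -> agree d M M'.
Proof.
move=> le h a ha; apply: h; apply: contra ha; rewrite /scratch /tmpa; lia.
Qed.

(** The straight pieces of [addr_code] write to cells 1 and 2 only, so their effect is computed on a
    pair of numbers over a fixed memory. *)
Definition regs12 (M N : memory) (ab : nat * nat) :=
  [/\ N 1 = ab.1, N 2 = ab.2 & forall i, i != 1 -> i != 2 -> N i = M i].

Definition val12 (M : memory) (ab : nat * nat) x :=
  if x == 1 then ab.1 else if x == 2 then ab.2 else M x.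

Definition set12 (ab : nat * nat) d v :=
  if d == 1 then (v, ab.2) else (ab.1, v).

Definition step12 (M : memory) (ab : nat * nat) (i : instr) :=
  match i with
  | IConst d k => set12 ab d k
  | IAdd d x y => set12 ab d (val12 M ab x + val12 M ab y)
  | ISub d x y => set12 ab d (val12 M ab x - val12 M ab y)
  | _ => ab
  end.

Definition ok12 (i : instr) : bool :=
  match i with
  | IConst d _ | IAdd d _ _ | ISub d _ _ => (d == 1) || (d == 2)
  | _ => false
  end.

Lemma regs12_foldl M N ab code : all ok12 code -> regs12 M N ab ->
  regs12 M (foldl exec1 N code) (foldl (step12 M) ab code).
Proof.
elim: code N ab => //= i code IH N ab /andP [hi hc] h; apply: IH => //.
have valE x : N x = val12 M ab x.
  rewrite /val12; case: h => h1 h2 h3.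
  by case: eqP => [->//|/eqP n1]; case: eqP => [->//|/eqP n2]; apply: h3.
have updP d v : (d == 1) || (d == 2) -> regs12 M (upd N d v) (set12 ab d v).
  case: h => h1 h2 h3 /orP [] /eqP ->; split=> //= j j1 j2.
    by rewrite /upd (negbTE j1) h3.
  by rewrite /upd (negbTE j2) h3.
by case: i hi => [d x|d x y|d x y|d a|a d|a t|] //= hd; rewrite ?valE; exact: updP.
Qed.

Lemma size_addr_code pc A y : size (addr_code pc A y) = 17.
Proof. by []. Qed.

Lemma addr_code_ok P pc A y M B : 2 < y < nreg -> nreg <= B -> M 0 = B ->
  code_at P pc (addr_code pc A y) ->
  exists M' t, [/\ nsteps P t (pc, M) = Some (pc + 17, M'),
    M' 2 = addr B A (M y), (forall a, a != 1 -> a != 2 -> M' a = M a)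
    & t <= 17].
Proof.
move=> hy hB M0; rewrite /addr_code.
set c1 := [:: IConst 1 nreg; ISub 1 1 y; IConst 2 1; IAdd 2 y 2;
  ISub 2 2 0; IAdd 1 1 2; IConst 2 A; IAdd 1 1 2; IConst 2 0; IAdd 2 y 2].
set c2 := [:: IAdd 2 2 2; IAdd 2 2 2; IAdd 2 2 2; IAdd 2 2 0;
  IConst 1 A; IAdd 2 2 1].
rewrite -[_ :: _]/(c1 ++ IJz 1 (pc + 17) :: c2).
case/code_at_cat=> h1 /code_at_cons [h2 h3].
have [y1 y2] : (y == 1 = false) /\ (y == 2 = false) by lia.
have r0 : regs12 M M (M 1, M 2) by [].
have := regs12_foldl (isT : all ok12 c1) r0.
(* The first component is the test value: it vanishes iff [nreg <= M y], [M y < B] and [A = 0]. *)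
have -> : foldl (step12 M) (M 1, M 2) c1 =
    (nreg - M y + (M y + 1 - B) + A, M y + 0).
  by rewrite /= /val12 /= y1 y2 /= M0.
have := nsteps_straight M h1 isT; move: (foldl exec1 M c1) => M1 e1 r1.
have [M1t M1y _] := r1; have e12 := nsteps_trans e1 (nsteps_jz M1 h2).
rewrite M1t /= in e12; rewrite /= addn0 in M1y.
have [z|nz] := boolP ((A == 0) && (nreg <= M y < B)).
  have z1 : nreg - M y + (M y + 1 - B) + A == 0 by move: z; clear; lia.
  rewrite z1 in e12; exists M1, 11; split=> //; first by rewrite /addr z.
  by case: r1.
have z1 : nreg - M y + (M y + 1 - B) + A == 0 = false.
  by move: nz; clear; lia.
rewrite z1 in e12.
have := regs12_foldl (isT : all ok12 c2) r1.
have := nsteps_straight M1 h3 isT; move: (foldl exec1 M1 c2) => M2 e3 [_ M22 M2o].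
exists M2, 17; split=> //.
- by rewrite (nsteps_trans e12 e3) /=; congr (Some (_, _)); lia.
rewrite M22 /addr (negbTE nz) /= /val12 /= M0; lia.
Qed.

#[local] Opaque addr_code.

Definition sim B (st : state) (M : memory) :=
  [/\ M 0 = B, forall x, vara x < nreg -> M (vara x) = vr st x
    & forall A y, A < 8 -> M (addr B A y) = ar st A y].

Lemma addr_ge B A y : nreg <= B -> nreg <= addr B A y.
Proof. by rewrite /addr; case: ifP; lia. Qed.

(** Cells that stay in place lie below [B]; from [B] on, the array and the index are remainder and
    quotient modulo 8 of the offset. *)
Lemma addr_inj B A A' y y' : A < 8 -> A' < 8 ->
  (addr B A y == addr B A' y') = (A == A') && (y == y').
Proof.
move=> h h'; rewrite /addr; case: ifP => e; case: ifP => e'; lia.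
Qed.

Lemma sim_agree B st M M' d : nreg <= B ->
  sim B st M -> agree d M M' -> sim B st M'.
Proof.
move=> hB [h0 hv ha] ag; split.
- by rewrite ag.
- by move=> x hx; rewrite ag ?hv // /scratch /tmpa /vara; lia.
move=> A y hA; rewrite ag ?ha //; have := addr_ge A y hB.
by rewrite /scratch /nreg; lia.
Qed.

Lemma cexpr_ok P B st e pc d M : nreg <= B -> wfe d e -> sim B st M ->
  code_at P pc (cexpr pc d e) ->
  exists M' t, [/\ nsteps P t (pc, M) = Some (pc + size (cexpr pc d e), M'),
    M' (tmpa d) = eval e st, agree d M M' & t <= ecost e].
Proof.
move=> hB; elim: e pc d M => [n|x|a IHa b IHb|a IHa b IHb|A a IHa] pc d M /=.
- case/andP=> hd _ hs hc.
  exists (upd M (tmpa d) n), 1; split=> //; first exact: (nsteps_straight M hc).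
    by rewrite /upd eqxx.
  move=> i hi; rewrite /upd; case: eqP => // E.
  by move: hi hd; rewrite E /scratch /tmpa /nreg; lia.
- case/andP=> hd hx hs hc.
  have := nsteps_straight M hc isT.
  set M' := foldl _ _ _ => e1.
  exists M', 2; split=> //.
    rewrite /M' /= /upd !eqxx addn0; case: hs => _ hv _.
    have -> : vara x == tmpa d = false by rewrite /vara /tmpa; lia.
    by rewrite hv.
  move=> i hi; rewrite /M' /= /upd; case: eqP => // E.
  by move: hi hd; rewrite E /scratch /tmpa /nreg; lia.
- case/and3P=> hd ha hb hs /code_at_cat [hca] /code_at_cat [hcb hc].
  have [M1 [t1 [e1 v1 g1 l1]]] := IHa _ _ _ ha hs hca.
  have [M2 [t2 [e2 v2 g2 l2]]] := IHb _ _ _ hb (sim_agree hB hs g1) hcb.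
  have e3 := nsteps_straight M2 hc isT.
  exists (upd M2 (tmpa d) (M2 (tmpa d) + M2 (tmpa d.+1))), (t1 + t2 + 1); split.
  + rewrite (nsteps_trans (nsteps_trans e1 e2) e3) /= !size_cat ?size_addr_code /=.
    by congr (Some (_, _)); lia.
  (* The right operand uses temporaries from depth [d.+1] on, so the left value has survived. *)
  + rewrite /upd eqxx v2 g2 ?v1 // /scratch /tmpa; lia.
  + have g12 := agree_trans g1 (agree_weak (leqnSn d) g2).
    move=> i hi; rewrite /upd; case: eqP => [E|_]; last exact: g12.
    by move: hi hd; rewrite E /scratch /tmpa /nreg; lia.
  + lia.
- case/and3P=> hd ha hb hs /code_at_cat [hca] /code_at_cat [hcb hc].
  have [M1 [t1 [e1 v1 g1 l1]]] := IHa _ _ _ ha hs hca.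
  have [M2 [t2 [e2 v2 g2 l2]]] := IHb _ _ _ hb (sim_agree hB hs g1) hcb.
  have e3 := nsteps_straight M2 hc isT.
  exists (upd M2 (tmpa d) (M2 (tmpa d) - M2 (tmpa d.+1))), (t1 + t2 + 1); split.
  + rewrite (nsteps_trans (nsteps_trans e1 e2) e3) /= !size_cat ?size_addr_code /=.
    by congr (Some (_, _)); lia.
  + rewrite /upd eqxx v2 g2 ?v1 // /scratch /tmpa; lia.
  + have g12 := agree_trans g1 (agree_weak (leqnSn d) g2).
    move=> i hi; rewrite /upd; case: eqP => [E|_]; last exact: g12.
    by move: hi hd; rewrite E /scratch /tmpa /nreg; lia.
  + lia.
case/and3P=> hd hA ha hs /code_at_cat [hca] /code_at_cat [hcb hc].
have [M1 [t1 [e1 v1 g1 l1]]] := IHa _ _ _ ha hs hca.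
have s1 := sim_agree hB hs g1.
have hy : 2 < tmpa d < nreg by rewrite hd /tmpa.
have M10 : M1 0 = B by case: s1.
have [M2 [t2 [e2 v2 g2 l2]]] := addr_code_ok hy hB M10 hcb.
rewrite size_addr_code in hc; have e3 := nsteps_straight M2 hc isT.
exists (upd M2 (tmpa d) (M2 (M2 2))), (t1 + t2 + 1); split.
- rewrite (nsteps_trans (nsteps_trans e1 e2) e3) /= !size_cat size_addr_code /=.
  by congr (Some (_, _)); lia.
- rewrite /upd eqxx v2 v1; have := addr_ge A (eval a st) hB.
  case: s1 => _ _ s1 ge; rewrite g2 ?s1 //; move: ge; rewrite /nreg; lia.
- move=> i hi; rewrite /upd; case: eqP => [E|_].
    by move: hi hd; rewrite E /scratch /tmpa /nreg; lia.
  by rewrite g2 ?g1 //; move: hi; rewrite /scratch; lia.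
by lia.
Qed.

Lemma sim_setv B st M M' x v : nreg <= B -> vara x < nreg ->
  sim B st M -> M' (vara x) = v ->
  (forall a, a != 1 -> a != vara x -> M' a = M a) -> sim B (setv st x v) M'.
Proof.
move=> hB hx [h0 hv ha] e ag; split.
- by rewrite ag // /vara; lia.
- move=> y hy /=; case: eqP => [-> //|ne]; rewrite ag ?hv //; move: ne; rewrite /vara; lia.
move=> A y hA; rewrite ag ?ha //; have := addr_ge A y hB; move: hx; rewrite /nreg; lia.
Qed.

Lemma sim_seta B st M A i v : nreg <= B -> A < 8 ->
  sim B st M -> sim B (seta st A i v) (upd M (addr B A i) v).
Proof.
move=> hB hA [h0 hv ha]; have ge := addr_ge A i hB; split.
- by rewrite /upd; case: eqP => // E; move: ge; rewrite -E.
- move=> x hx; rewrite /upd; case: eqP => [E|_]; last exact: hv.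
  by move: ge hx; rewrite -E; lia.
by move=> A' y hA'; rewrite /upd addr_inj //= ha.
Qed.

(** Counters do not belong to the simulated state, so the induction must also carry that those of
    enclosing loops are preserved. *)
Lemma ccmd_ok P B c st pc d M : nreg <= B -> wfc d c -> sim B st M ->
  code_at P pc (ccmd pc d c) ->
  exists M' t, [/\ nsteps P t (pc, M) = Some (pc + size (ccmd pc d c), M'),
    sim B (run c st) M', (forall e, e < d -> cnta e < nreg -> M' (cnta e) = M (cnta e))
    & t <= cost c st].
Proof.
have cnt_scr e : ~~ scratch 0 (cnta e) by rewrite /scratch /cnta /tmpa; lia.
move=> hB; elim: c st pc d M => [|x e|A e1 e2|a IHa b IHb|e a IHa b IHb|x b IHb] st pc d M /=.
- by move=> _ hs _; exists M, 0; rewrite addn0.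
- case/andP=> hx he hs /code_at_cat [hc1 hc2].
  have [M1 [t1 [e1 v1 g1 l1]]] := cexpr_ok hB he hs hc1.
  have e3 := nsteps_straight M1 hc2 isT; set M2 := foldl _ _ _ in e3.
  have M2x : M2 (vara x) = eval e st by rewrite /M2 /= /upd !eqxx addn0.
  have M2o i : i != 1 -> i != vara x -> M2 i = M1 i.
    by move=> /negbTE h1 /negbTE h2; rewrite /M2 /= /upd h2 h1.
  exists M2, (t1 + 2); split.
  + by rewrite (nsteps_trans e1 e3) /= !size_cat addnA.
  + exact: (sim_setv hB hx (sim_agree hB hs g1) M2x M2o).
  + by move=> i hi _; rewrite M2o ?g1 //; rewrite /cnta /vara; lia.
  + by lia.
- case/and3P=> hA he1 he2 hs /code_at_cat [hc1] /code_at_cat [hc2] /code_at_cat [hc3 hc4].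
  have [M1 [t1 [x1 v1 g1 l1]]] := cexpr_ok hB he1 hs hc1.
  have s1 := sim_agree hB hs g1.
  have [M2 [t2 [x2 v2 g2 l2]]] := cexpr_ok hB he2 s1 hc2.
  have s2 := sim_agree hB s1 g2.
  have M20 : M2 0 = B by case: s2.
  have [M3 [t3 [x3 v3 g3 l3]]] :=
    addr_code_ok (isT : 2 < tmpa 0 < nreg) hB M20 hc3.
  rewrite size_addr_code in hc4.
  have g3' : agree 0 M2 M3.
    by move=> i hi; apply: g3; move: hi; rewrite /scratch; lia.
  have s3 := sim_agree hB s2 g3'.
  have x4 := nsteps_straight M3 hc4 isT.
  have w1 : M2 (tmpa 0) = eval e1 st.
    by rewrite g2 ?v1.
  have w2 : M3 (tmpa 1) = eval e2 st by rewrite g3 ?v2.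
  exists (upd M3 (addr B A (eval e1 st)) (eval e2 st)), (t1 + t2 + t3 + 1); split.
  + rewrite (nsteps_trans (nsteps_trans (nsteps_trans x1 x2) x3) x4) /= v3 w1 w2.
    by rewrite !size_cat ?size_addr_code /=; congr (Some (_, _)); lia.
  + exact: sim_seta.
  + have ge := addr_ge A (eval e1 st) hB.
    move=> i _ hi; rewrite /upd; case: eqP => [E|_]; first by lia.
    by rewrite g3' ?(agree_weak (leq0n 1) g2) ?g1.
  + by lia.
- case/andP=> ha hb hs /code_at_cat [hca hcb].
  have [M1 [t1 [x1 s1 g1 l1]]] := IHa _ _ _ _ ha hs hca.
  have [M2 [t2 [x2 s2 g2 l2]]] := IHb _ _ _ _ hb s1 hcb.
  exists M2, (t1 + t2); split=> //.
  + by rewrite (nsteps_trans x1 x2) size_cat addnA.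
  + by move=> i hi hr; rewrite g2 ?g1.
  + by lia.
- case/and3P=> he ha hb hs /code_at_cat [hc1] /code_at_cons [hj].
  case/code_at_cat=> hca; rewrite -cat1s -(cat1s (IJz _ _)).
  case/code_at_cat=> hz /code_at_cat [] /code_at_cons [hj2 _] hcb.
  have [M1 [t1 [x1 v1 g1 l1]]] := cexpr_ok hB he hs hc1.
  have x2 := nsteps_trans x1 (nsteps_jz M1 hj).
  have s1 := sim_agree hB hs g1; rewrite v1 in x2.
  case: eqP x2 => [E|NE] /= x2.
    have hcb' : code_at P (pc + size (cexpr pc 0 e) + 1 +
        size (ccmd (pc + size (cexpr pc 0 e)).+1 d a) + 2)
      (ccmd (pc + size (cexpr pc 0 e) + 1 +
        size (ccmd (pc + size (cexpr pc 0 e)).+1 d a) + 2) d b).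
      by move: hcb => /=; congr (code_at _ _ _); lia.
    have [M3 [t3 [x3 s3 g3 l3]]] := IHb _ _ _ _ hb s1 hcb'.
    exists M3, (t1 + 1 + t3); split=> //.
    + rewrite (nsteps_trans x2 x3) !size_cat /= size_cat /=.
      by congr (Some (_, _)); lia.
    + by move=> i hi hr; rewrite g3 ?g1.
    + by lia.
  have [M3 [t3 [x3 s3 g3 l3]]] := IHa _ _ _ _ ha s1 hca.
  have x4 := nsteps_straight M3 hz isT.
  have x5 := nsteps_jz (upd M3 1 0) hj2.
  have g5 : agree 0 M3 (upd M3 1 0).
    by move=> i hi; rewrite /upd; case: eqP hi => // ->.
  exists (upd M3 1 0), (t1 + 1 + t3 + 1 + 1); split=> //.
  + rewrite (nsteps_trans (nsteps_trans (nsteps_trans x2 x3) x4) x5) /=.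
    by rewrite !size_cat /= size_cat /=; congr (Some (_, _)); lia.
  + exact: sim_agree s3 g5.
  + by move=> i hi hr; rewrite g5 ?g3 ?g1.
  + by lia.
case/and3P=> hx hd hb hs.
set cb := ccmd _ _ _; set cz := [:: IConst 1 1; _; _; _] => hc.
have /code_at_cat [hc1 /code_at_cons [hj /code_at_cat [hcb hc2z]]] : code_at P pc
  ([:: IConst 1 0; IAdd (cnta d) (vara x) 1]
    ++ IJz (cnta d) (pc + size cb + 7) :: cb ++ cz) := hc.
have /code_at_cat [hc2 /code_at_cons [hj2 _]] : code_at P _
  ([:: IConst 1 1; ISub (cnta d) (cnta d) 1; IConst 1 0]
    ++ [:: IJz 1 (pc + 2)]) := hc2z.
have x1 := nsteps_straight M hc1 isT.
set M1 := foldl _ _ _ in x1.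
have M1c : M1 (cnta d) = vr st x.
  by rewrite /M1 /= /upd !eqxx addn0; case: hs => _ hv _; apply: hv.
have M1o i : i != 1 -> i != cnta d -> M1 i = M i.
  by move=> /negbTE h1 /negbTE h2; rewrite /M1 /= /upd h2 h1.
have cnt_sim s N N' : sim B s N ->
    (forall i, i != 1 -> i != cnta d -> N' i = N i) -> sim B s N'.
  case=> h0 hv ha ag; split.
  - by rewrite ag // /cnta; lia.
  - by move=> y hy; rewrite ag ?hv // /cnta /vara; lia.
  move=> A y hA; rewrite ag ?ha //; have := addr_ge A y hB; move: hd; rewrite /nreg; lia.
have s1 := cnt_sim _ _ _ hs M1o.
(* Starting at the loop test, the counter holds the number of passes still to run; state and memory
   are generalised for the induction. *)
have loop n s N : sim B s N -> N (cnta d) = n ->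
  exists M' t, [/\ nsteps P t (pc + 2, N) = Some (pc + size cb + 7, M'),
    sim B (iter n (run b) s) M',
    (forall e, e < d -> cnta e < nreg -> M' (cnta e) = N (cnta e))
    & t <= 1 + \sum_(i < n) (cost b (iter i (run b) s) + 5)].
  elim: n s N => [|n IHn] s N sN Nc.
    exists N, 1; split=> //.
    by rewrite (nsteps_jz N hj) Nc.
  have y1 := nsteps_jz N hj; rewrite Nc /= in y1.
  have [N2 [t2 [y2 s2 g2 l2]]] : exists M' t,
      [/\ nsteps P t ((pc + 2).+1, N) = Some ((pc + 2).+1 + size cb, M'),
      sim B (run b s) M',
      (forall e, e < d.+1 -> cnta e < nreg -> M' (cnta e) = N (cnta e))
      & t <= cost b s].
    rewrite -addnS; apply: IHb => //.
    by move: hcb; rewrite -addnS.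
  have y3 := nsteps_straight N2 hc2 isT; set N3 := foldl _ _ _ in y3.
  have y4 := nsteps_jz N3 hj2.
  have N3c : N3 (cnta d) = n.
    by rewrite /N3 /= /upd !eqxx /= g2 // Nc subn1.
  have N3o i : i != 1 -> i != cnta d -> N3 i = N2 i.
    by move=> /negbTE h1 /negbTE h2; rewrite /N3 /= /upd h1 h2.
  have [N4 [t4 [y5 s4 g4 l4]]] := IHn _ _ (cnt_sim _ _ _ s2 N3o) N3c.
  have N31 : N3 1 = 0 by rewrite /N3 /= /upd.
  rewrite N31 /= in y4.
  exists N4, (1 + t2 + 3 + 1 + t4); split.
  + exact: (nsteps_trans (nsteps_trans (nsteps_trans (nsteps_trans y1 y2) y3) y4) y5).
  + by rewrite iterSr.
  + move=> i hi hr; rewrite g4 // N3o ?g2 //; rewrite /cnta; lia.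
  + rewrite big_ord_recl.
    under eq_bigr => i _ do rewrite lift0 iterSr.
    move: l4 l2 => /=; set S := \sum_(_ < n) _.
    by lia.
have [M2 [t2 [x2 s2 g2 l2]]] := loop _ _ _ s1 M1c.
exists M2, (2 + t2); split=> //.
- by rewrite (nsteps_trans x1 x2) !size_cat /=; congr (Some (_, _)); lia.
by move=> i hi hr; rewrite g2 ?M1o //; rewrite /cnta; lia.
Qed.

(** * Moving the input out of the registers and the output back *)

(* Computed from the header of the encoding alone: beyond the end of the input
   and beyond every output cell. *)
Definition heap_base (w : seq nat) :=
  2 * nth 0 w 2 + 3 + 4 * nth 0 w (2 * nth 0 w 2 + 3) + nreg.+1.

(** The offset [8 * i] from the base is the relocated place of entry [i] of array 0. Saving starts
    at 2: cells 0 and 1 are overwritten while the base is computed. *)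
Definition save_reg i := [:: IConst 1 (8 * i); IAdd 1 1 0; IStore 1 i].
Definition restore_reg i := [:: IConst 1 (8 * i); IAdd 1 1 0; ILoad i 1].

Definition prologue : program :=
  [:: IAdd 0 2 2; IConst 1 3; IAdd 0 0 1; ILoad 1 0; IAdd 1 1 1; IAdd 1 1 1;
      IAdd 0 0 1; IConst 1 nreg.+1; IAdd 0 0 1]
  ++ flatten [seq save_reg i | i <- iota 2 (nreg - 2)].

(** Cell 1 serves as address and cell 0 as base until the end, so these two are restored last. *)
Definition epilogue : program :=
  flatten [seq restore_reg i | i <- iota 2 (nreg - 2)]
  ++ [:: IConst 1 8; IAdd 1 1 0; ILoad 1 1; ILoad 0 0].

Lemma foldl_save_reg M m n : 1 < m -> m + n <= nreg -> nreg <= M 0 ->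
  let M' := foldl exec1 M (flatten [seq save_reg i | i <- iota m n]) in
  (forall i, m <= i < m + n -> M' (M 0 + 8 * i) = M i) /\
  (forall a, a != 1 -> (forall i, m <= i < m + n -> a != M 0 + 8 * i) ->
     M' a = M a).
Proof.
elim: n m M => [|n IH] m M hm hn hB /=; first by split=> // i; lia.
set M1 := upd _ _ _.
have M1E a : a != 1 -> M1 a = if a == M 0 + 8 * m then M m else M a.
  move=> a1; rewrite /M1 /upd /= (negbTE a1) addnC.
  have -> : m == 1 = false by lia.
  by [].
have M10 : M1 0 = M 0 by rewrite M1E //; case: eqP => // E; move: hB; rewrite /nreg; lia.
have M1lo i : 1 < i < nreg -> M1 i = M i.
  by move=> hi; rewrite M1E; [case: eqP => // E|]; lia.
have [|||h1 h2] := IH m.+1 M1; rewrite ?M10 //; try lia.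
rewrite M10 in h1 h2; split=> [i hi|a a1 ha].
  have [->|ne] := eqVneq i m.
    rewrite h2; [|move: hB; rewrite /nreg; lia|by move=> j hj; lia].
    by rewrite M1E ?eqxx //; move: hB; rewrite /nreg; lia.
  by rewrite h1 ?M1lo //; lia.
rewrite h2 // => [|i hi]; last by apply: ha; lia.
by rewrite M1E // (negbTE (ha m _)) //; lia.
Qed.

Lemma foldl_restore_reg M m n : 1 < m -> m + n <= nreg -> nreg <= M 0 ->
  let M' := foldl exec1 M (flatten [seq restore_reg i | i <- iota m n]) in
  (forall i, m <= i < m + n -> M' i = M (M 0 + 8 * i)) /\
  (forall a, a != 1 -> ~~ (m <= a < m + n) -> M' a = M a).
Proof.
elim: n m M => [|n IH] m M hm hn hB /=; first by split=> // i; lia.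
set M1 := upd _ _ _.
have M1E a : a != 1 -> M1 a = if a == m then M (M 0 + 8 * m) else M a.
  move=> a1; rewrite /M1 /upd /= (negbTE a1) addnC.
  by have -> : M 0 + 8 * m == 1 = false by move: hB; rewrite /nreg; lia.
have M10 : M1 0 = M 0 by rewrite M1E //; case: eqP => // E; lia.
have [|||h1 h2] := IH m.+1 M1; rewrite ?M10 //; try lia.
rewrite M10 in h1; split=> [i hi|a a1 ha].
  have [->|ne] := eqVneq i m.
    by rewrite h2; [rewrite M1E ?eqxx //|..]; lia.
  rewrite h1; last by lia.
  by rewrite M1E; [case: eqP => // E|]; move: hB; rewrite /nreg; lia.
rewrite h2 //; last by lia.
by rewrite M1E //; case: eqP => // E; lia.
Qed.

Lemma prologue_ok w : let M := foldl exec1 (init_mem w) prologue in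
  [/\ M 0 = heap_base w,
    forall i, 1 < i < nreg -> M (heap_base w + 8 * i) = nth 0 w i &
    forall a, nreg <= a -> (forall i, 1 < i < nreg -> a != heap_base w + 8 * i) ->
      M a = nth 0 w a].
Proof.
rewrite foldl_cat; set N := foldl _ _ (IAdd _ _ _ :: _).
have N0 : N 0 = heap_base w.
  rewrite /heap_base -!/(init_mem w _) mul2n -addnn /N.
  (* Written with three successors, the address of the constraint count is visibly neither 0 nor 1,
     so the load still reads the input. *)
  by move: (init_mem w) => M0; rewrite /= /upd /= !addn3 /=; lia.
have No a : 1 < a -> N a = nth 0 w a.
  by move=> ha; rewrite /N /= /upd /= /init_mem; do 2 (case: eqP => [E|_]; first by lia).
have BN : nreg <= N 0 by rewrite N0 /heap_base; lia.
clearbody N; have := @foldl_save_reg N 2 (nreg - 2) isT isT BN.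
move: (foldl exec1 N _) => M'; rewrite N0 subnKC //= => -[h1 h2].
rewrite N0 in BN; move: (heap_base w) N0 h1 h2 BN => B N0 h1 h2 hB; split.
- by rewrite h2 ?N0 // => i _; move: hB; clear; rewrite /nreg; lia.
- by move=> i hi; rewrite h1 ?No //; case/andP: hi.
move=> a ha hi; rewrite h2 ?No //; by move: ha; clear; rewrite /nreg; lia.
Qed.

Lemma prologue_input w y : size w <= heap_base w -> 1 < y ->
  foldl exec1 (init_mem w) prologue (addr (heap_base w) 0 y) = nth 0 w y.
Proof.
have hB : nreg <= heap_base w by rewrite /heap_base; lia.
have := prologue_ok w; move: (foldl _ _ _) => M [_ lo hi] hw hy.
move: (heap_base w) hB hw lo hi => B hB hw lo hi.
rewrite /addr eqxx addn0; case: (ltnP y nreg) => yr /=; first by rewrite lo ?hy.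
case: ltnP => yB.
  by rewrite hi // => i _; move: yB; clear; lia.
rewrite hi; [|by move: yr; clear; lia|by move: yr; clear => yr i; lia].
(* From index [B] on, both sides read past the end of the input and are 0. *)
by rewrite !nth_default //; move: hw yB; clear; lia.
Qed.

Lemma epilogue_ok M B : M 0 = B -> nreg <= B ->
  let M' := foldl exec1 M epilogue in
  forall i, i < B -> M' i = M (addr B 0 i).
Proof.
move=> M0 hB; rewrite foldl_cat.
have BM : nreg <= M 0 by rewrite M0.
have := @foldl_restore_reg M 2 (nreg - 2) isT isT BM.
move: (foldl exec1 M _) => N; rewrite subnKC //= M0 => -[h1 h2].
have N0 : N 0 = B by rewrite h2.
have B1 : B == 1 = false by move: hB; clear; rewrite /nreg; lia.
have B0 : B == 0 = false by move: hB; clear; rewrite /nreg; lia.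
have hi1 a : nreg <= a -> N a = M a.
  by move=> ha; rewrite h2 //; move: ha; clear; rewrite /nreg; lia.
move=> i hi; rewrite /upd /= N0; case: eqP => [->|i0].
  by rewrite /addr /= !addn0 ?B1 ?B0 hi1.
case: eqP => [->|i1].
  rewrite /addr /= addn0 addnC muln1 hi1 //; move: hB; clear; lia.
rewrite /addr eqxx hi andbT /=; case: (leqP nreg i) => ir.
  exact: hi1.
by rewrite h1 ?addn0 // ir andbT; move: i0 i1; clear; lia.
Qed.

Lemma exec_sandwich pro mid epi M0 M2 t : let P := pro ++ mid ++ epi in
  all straight pro -> all straight epi ->
  nsteps P t (size pro, foldl exec1 M0 pro) = Some (size pro + size mid, M2) ->
  exec P (size pro + t + size epi) (0, M0) = Some (foldl exec1 M2 epi).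
Proof.
move=> P sp se x2.
have cP : code_at P 0 P by move=> i _; rewrite add0n.
have /code_at_cat [cp /code_at_cat [_ ce]] := cP.
have x1 := nsteps_straight M0 cp sp; have x3 := nsteps_straight M2 ce se.
rewrite add0n in x1 x3.
apply: (exec_nsteps (nsteps_trans (nsteps_trans x1 x2) x3)).
by rewrite /step nth_default // /P !size_cat addnA.
Qed.

Lemma straight_prologue : all straight prologue.
Proof. by []. Qed.

Lemma straight_epilogue : all straight epilogue.
Proof. by []. Qed.

Lemma compile_correct c : wfc 0 c ->
  exists (P : program) a, forall w, size w <= heap_base w ->
  exists st0, (forall y, 1 < y -> ar st0 0 y = nth 0 w y) /\
  exists T M, [/\ T <= a + cost c st0,
    exec P T (0, init_mem w) = Some M
    & forall i, i < heap_base w -> M i = ar (run c st0) 0 i].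
Proof.
move=> wf.
have M1in w y := @prologue_input w y; have M10 w := prologue_ok w.
have epi := epilogue_ok.
move: prologue epilogue straight_prologue straight_epilogue M1in M10 epi.
move=> pro epi sp se M1in M10 epiE.
pose code := ccmd (size pro) 0 c.
exists (pro ++ code ++ epi), (size pro + size epi) => w hw.
have [{}M10 _ _] := M10 w; have {}M1in y := M1in w y hw.
have hB : nreg <= heap_base w by rewrite /heap_base; lia.
set B := heap_base w in hw hB M10 M1in *.
set M1 := foldl exec1 _ pro in M10 M1in.
(* The initial state is read off the memory after the prologue, so the simulation holds by
   definition, whatever the registers contain. *)
exists (State (fun x => M1 (vara x)) (fun A y => M1 (addr B A y))).
set st0 := State _ _; split; first exact: M1in.
have s0 : sim B st0 M1 by split.
have cc : code_at (pro ++ code ++ epi) (size pro) code.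
  have cP : code_at (pro ++ code ++ epi) 0 (pro ++ code ++ epi) by move=> i _; rewrite add0n.
  by have /code_at_cat [_ /code_at_cat []] := cP.
have [M2 [t [x2 s2 _ l2]]] := ccmd_ok hB wf s0 cc.
have [M20 _ M2a] := s2.
exists (size pro + t + size epi), (foldl exec1 M2 epi); split.
- by move: l2; clear; lia.
- exact: exec_sandwich x2.
by move=> i hi; rewrite (epiE _ _ M20 hB) // M2a.
Qed.

(** * Reasoning about structured programs *)

Fixpoint wvars (c : cmd) : seq nat :=
  match c with
  | Asg x _ => [:: x]
  | Seq a b | If _ a b => wvars a ++ wvars b
  | Repeat _ b => wvars b
  | _ => [::]
  end.

Fixpoint warrs (c : cmd) : seq nat :=
  match c with
  | Put A _ _ => [:: A]
  | Seq a b | If _ a b => warrs a ++ warrs b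
  | Repeat _ b => warrs b
  | _ => [::]
  end.

Definition same (V W : seq nat) (st s : state) :=
  (forall x, x \notin V -> vr s x = vr st x) /\
  (forall A, A \notin W -> forall y, ar s A y = ar st A y).

Lemma same_refl V W st : same V W st st.
Proof. by []. Qed.

Lemma same_trans V W s1 s2 s3 :
  same V W s1 s2 -> same V W s2 s3 -> same V W s1 s3.
Proof.
move=> [v1 a1] [v2 a2]; split=> [x hx|A hA y]; first by rewrite v2 ?v1.
by rewrite a2 ?a1.
Qed.

Lemma same_sub V W V' W' s1 s2 : {subset V <= V'} -> {subset W <= W'} ->
  same V W s1 s2 -> same V' W' s1 s2.
Proof.
move=> hV hW [v a]; split=> [x hx|A hA y]; first by apply: v; apply: contra hx; apply: hV.
by apply: a; apply: contra hA; apply: hW.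
Qed.

Lemma run_same c st : same (wvars c) (warrs c) st (run c st).
Proof.
elim: c st => [|x e|A e1 e2|a IHa b IHb|e a IHa b IHb|x b IHb] st //=.
- by split=> // y; rewrite inE /=; case: eqP.
- by split=> // A'; rewrite inE /= => /negbTE ->.
- apply: same_trans (same_sub _ _ (IHa st)) (same_sub _ _ (IHb _)) => y;
  by rewrite mem_cat => ->; rewrite ?orbT.
- by case: ifP => _; [apply: same_sub (IHa st)|apply: same_sub (IHb st)] => y;
  rewrite mem_cat => ->; rewrite ?orbT.
elim: (vr st x) => [|n IH] //=; exact: same_trans IH (IHb _).
Qed.

Lemma same_cons V W x st s v :
  same V W st s -> same (x :: V) W st (setv s x v).
Proof.
move=> [hv ha]; split=> [y|A hA y] /=; last exact: ha.
by rewrite inE negb_or => /andP [/negbTE -> hy]; apply: hv.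
Qed.

Definition For i n b :=
  Seq (Asg i (Cst 0)) (Repeat n (Seq b (Asg i (Plus (Var i) (Cst 1))))).

(** The increment follows the body, so the invariant must survive writes to [i]. In exchange, each
    pass may assume that [i] equals the pass number and that everything outside the write sets is as
    at the start. *)
Lemma For_ind (Inv : nat -> state -> Prop) i n b st :
  i != n -> i \notin wvars b ->
  (forall j s v, Inv j s -> Inv j (setv s i v)) ->
  Inv 0 st ->
  (forall j s, j < vr st n -> vr s i = j -> same (i :: wvars b) (warrs b) st s ->
     Inv j s -> Inv j.+1 (run b s)) ->
  Inv (vr st n) (run (For i n b) st).
Proof.
move=> ni ib ins I0 IS; rewrite /=.
have -> : (if n == i then 0 else vr st n) = vr st n by rewrite eq_sym (negbTE ni).
set f := (fun s => _).
suff H j : j <= vr st n -> [/\ vr (iter j f (setv st i 0)) i = j,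
    same (i :: wvars b) (warrs b) st (iter j f (setv st i 0)) &
    Inv j (iter j f (setv st i 0))] by case: (H _ (leqnn _)).
elim: j => [_|j IH hj] /=.
  split; first by rewrite eqxx.
  - by apply: same_cons.
  - exact: ins.
have [|e sm Ij] := IH; first exact: ltnW.
move: (iter j f _) e sm Ij => s e sm Ij.
have [rv ra] := run_same b s.
rewrite /f; split.
- by rewrite /= eqxx rv // e addn1.
- apply: same_trans sm _; apply: same_cons.
  exact: run_same.
- by apply: ins; apply: IS => //; apply: same_trans sm (same_refl _ _ _).
Qed.

(** Row-major traversal of a square: [Inv a c] describes the moment when [a] full rows and [c] cells
    of the next one are finished. *)
Lemma For2_ind (Inv : nat -> nat -> state -> Prop) i i' n b st :
  [&& i != n, i' != n, i != i', i \notin wvars b, i' \notin wvars b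
    & n \notin wvars b] ->
  (forall a c s v, Inv a c s -> Inv a c (setv s i v)) ->
  (forall a c s v, Inv a c s -> Inv a c (setv s i' v)) ->
  Inv 0 0 st ->
  (forall a s, a < vr st n -> Inv a (vr st n) s -> Inv a.+1 0 s) ->
  (forall a c s, a < vr st n -> c < vr st n -> vr s i = a -> vr s i' = c ->
     same (i :: i' :: wvars b) (warrs b) st s -> Inv a c s ->
     Inv a c.+1 (run b s)) ->
  Inv (vr st n) 0 (run (For i n (For i' n b)) st).
Proof.
case/and5P=> n1 n2 n3 w1 /andP [w2 w3] in1 in2 I0 IT IS.
have wF : wvars (For i' n b) =i i' :: wvars b.
  by move=> x; rewrite /= inE mem_cat !inE; case: (x == i'); rewrite ?orbF.
have wA : warrs (For i' n b) = warrs b by rewrite /= cats0.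
apply: (@For_ind (fun a s => Inv a 0 s)) => //.
- by rewrite wF inE negb_or n3.
- by move=> a s v; apply: in1.
move=> a s ha sa sm Ia; apply: IT => //.
have sn : vr s n = vr st n.
  case: sm => sv _; apply: sv; rewrite inE wF inE !negb_or w3.
  by rewrite eq_sym n1 eq_sym n2.
rewrite -sn; apply: (@For_ind (fun c s => Inv a c s)) => //.
- by move=> c s' v; apply: in2.
move=> c s' hc sc sm' Ic; apply: IS => //; rewrite -?sn //.
- case: sm' => sv _; rewrite sv //; by rewrite inE negb_or n3.
apply: (@same_trans _ _ _ s).
  apply: same_sub sm => x; last by rewrite wA.
  by rewrite in_cons wF => h; rewrite in_cons.
by apply: same_sub sm' => x //; rewrite !inE => ->; rewrite orbT.
Qed.

(** * Polynomial running time *)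

(* Variables 0 and 1 are never written and bound every loop, so that running
   times are polynomial in their values. *)
Fixpoint okc (c : cmd) : bool :=
  match c with
  | Skip => true
  | Asg x _ => 1 < x
  | Put _ _ _ => true
  | Seq a b | If _ a b => okc a && okc b
  | Repeat x b => (x <= 1) && okc b
  end.

Fixpoint bnd (c : cmd) N : nat :=
  match c with
  | Skip => 0
  | Asg _ e => ecost e + 2
  | Put _ e1 e2 => ecost e1 + ecost e2 + 18
  | Seq a b => bnd a N + bnd b N
  | If e a b => ecost e + 3 + (bnd a N + bnd b N)
  | Repeat x b => 3 + N * (bnd b N + 5)
  end.

Lemma okc_wvars c x : okc c -> x <= 1 -> x \notin wvars c.
Proof.
move=> hc hx; elim: c hc => //= [y e hy|a IHa b IHb|e a IHa b IHb|y b IHb].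
- by rewrite inE; lia.
- by case/andP=> /IHa ha /IHb hb; rewrite mem_cat negb_or ha.
- by case/andP=> /IHa ha /IHb hb; rewrite mem_cat negb_or ha.
- by case/andP.
Qed.

Lemma cost_bnd c N st : okc c -> vr st 0 <= N -> vr st 1 <= N ->
  cost c st <= bnd c N.
Proof.
elim: c st => //= [a IHa b IHb|e a IHa b IHb|x b IHb] st.
- case/andP=> ha hb h0 h1; have [rv _] := run_same a st.
  by apply: leq_add; [exact: IHa|apply: IHb; rewrite ?rv // okc_wvars].
- case/andP=> ha hb h0 h1; have := IHa _ ha h0 h1; have := IHb _ hb h0 h1.
  by case: ifP => _; lia.
case/andP=> hx hb h0 h1; rewrite leq_add2l.
have hxN : vr st x <= N by case: x hx => [|[]].
apply: leq_trans (leq_mul hxN (leqnn _)).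
rewrite -[X in _ <= X * _]card_ord -sum_nat_const; apply: leq_sum => i _.
(* The two bounding variables survive all passes, so every pass obeys the same bound. *)
rewrite leq_add2r; have vE y : y <= 1 -> vr (iter i (run b) st) y = vr st y.
  move=> hy; elim: (nat_of_ord i) => //= m IH.
  by have [rv _] := run_same b (iter m (run b) st); rewrite rv ?IH // okc_wvars.
by apply: IHb => //; rewrite vE.
Qed.

(** Each nested loop raises the degree by one; for a sum, both degrees are lifted to their sum. *)
Lemma bnd_poly c : exists a d, forall N, bnd c N <= a * N.+1 ^ d.
Proof.
have cst m : exists a d, forall N, m <= a * N.+1 ^ d.
  by exists m, 0 => N; rewrite expn0 muln1.
have add f g : (exists a d, forall N, f N <= a * N.+1 ^ d) ->
    (exists a d, forall N, g N <= a * N.+1 ^ d) ->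
    exists a d, forall N, f N + g N <= a * N.+1 ^ d.
  case=> a [d h] [a' [d' h']]; exists (a + a'), (d + d') => N.
  rewrite mulnDl; apply: leq_add.
    by apply: leq_trans (h N) _; rewrite leq_mul2l leq_pexp2l ?orbT // leq_addr.
  by apply: leq_trans (h' N) _; rewrite leq_mul2l leq_pexp2l ?orbT // leq_addl.
elim: c => [|x e|A e1 e2|a IHa b IHb|e a IHa b IHb|x b IHb] /=; try exact: cst.
- exact: add.
- exact: (add _ _ (cst _) (add _ _ IHa IHb)).
apply: (add); first exact: cst.
have [a [d h]] := add _ _ IHb (cst 5).
exists a, d.+1 => N; rewrite expnS mulnCA; apply: leq_mul => //.
Qed.

(** * The algorithm *)

Fixpoint rvars (e : expr) : seq nat :=
  match e with
  | Cst _ => [::]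
  | Var x => [:: x]
  | Plus a b | Minus a b => rvars a ++ rvars b
  | Get _ a => rvars a
  end.

Fixpoint rarrs (e : expr) : seq nat :=
  match e with
  | Plus a b | Minus a b => rarrs a ++ rarrs b
  | Get A a => A :: rarrs a
  | _ => [::]
  end.

Lemma eval_same V W st s e : same V W st s ->
  all [predC V] (rvars e) -> all [predC W] (rarrs e) -> eval e s = eval e st.
Proof.
case=> sv sa; elim: e => //= [x|a IHa b IHb|a IHa b IHb|A a IHa].
- by rewrite andbT => hx _; apply: sv.
- by rewrite !all_cat => /andP [? ?] /andP [? ?]; rewrite IHa ?IHb.
- by rewrite !all_cat => /andP [? ?] /andP [? ?]; rewrite IHa ?IHb.
by move=> h1 /andP [h2 h3]; rewrite IHa // sa.
Qed.

Lemma runSeq a b st : run (Seq a b) st = run b (run a st).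
Proof. by []. Qed.

Lemma runAsg x e st : run (Asg x e) st = setv st x (eval e st).
Proof. by []. Qed.

Lemma runPut A e1 e2 st : run (Put A e1 e2) st = seta st A (eval e1 st) (eval e2 st).
Proof. by []. Qed.

Lemma runIf e a b st :
  run (If e a b) st = if eval e st != 0 then run a st else run b st.
Proof. by []. Qed.

Lemma runSkip st : run Skip st = st.
Proof. by []. Qed.

Arguments run : simpl never.

(** * The text of the dynamic program *)

Notation vk := 0 (only parsing).
Notation vnc := 1 (only parsing).
Notation vp := 2 (only parsing).
Notation vq := 3 (only parsing).
Notation vrr := 4 (only parsing).
Notation vx := 5 (only parsing).
Notation vc := 6 (only parsing).
Notation vj := 7 (only parsing).
Notation vacc := 8 (only parsing).
Notation vpw := 9 (only parsing).
Notation vw := 10 (only parsing).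
Notation vbest := 11 (only parsing).
Notation vh := 12 (only parsing).
Notation vth := 13 (only parsing).

Notation aio := 0 (only parsing).
Notation arow := 1 (only parsing).
Notation apow := 2 (only parsing).
Notation acap := 3 (only parsing).
Notation acur := 4 (only parsing).
Notation anew := 5 (only parsing).

Definition dbl e := Plus e e.
Definition src i := Get aio (Plus (Cst 3) (dbl (Var i))).
Definition dst i := Get aio (Plus (Cst 4) (dbl (Var i))).
(** The header and the demands fill [3 + 2 * k] cells and the constraint count one more, so
    constraint [c] starts at [4 + 2 * k + 4 * c]. *)
Definition fld f := Get aio (Plus (Cst (4 + f))
  (Plus (dbl (Var vk)) (dbl (dbl (Var vc))))).
(** The machine cannot multiply, so the row offsets [p * k] are tabulated in [arow]. *)
Definition idx p q := Plus (Get arow (Var p)) (Var q).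
Definition cell A p q := Get A (idx p q).

Definition prep_body :=
  Seq (Put arow (Var vp) (Var vacc))
  (Seq (Asg vacc (Plus (Var vacc) (Var vk)))
  (Seq (Put apow (Var vp) (Var vpw))
       (Asg vpw (dbl (Var vpw))))).

Definition prep :=
  Seq (Asg vacc (Cst 0)) (Seq (Asg vpw (Cst 1)) (For vp vk prep_body)).

(** With truncated subtraction, [w - (w - x)] is the minimum of [w] and [x]. *)
Definition clip_when e :=
  If e Skip (Asg vw (Minus (Var vw) (Minus (Var vw) (fld 3)))).

(* Truncated subtractions: the value is [0] iff the constraint has type [n] and
   both [e1] and [e2] vanish. *)
Definition typ_test n e1 e2 :=
  Plus (Plus (Minus (fld 0) (Cst n)) (Minus (Cst n) (fld 0))) (Plus e1 e2).

Definition test1 := typ_test 1 (Minus (fld 1) (src vp)) (Minus (src vq) (fld 2)).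
Definition test2 := typ_test 2 (Minus (fld 1) (dst vp)) (Minus (dst vq) (fld 2)).
Definition test3 := typ_test 3 (Minus (src vq) (fld 1)) (Minus (fld 2) (dst vp)).
Definition test4 := typ_test 4 (Minus (fld 1) (src vp)) (Minus (dst vq) (fld 2)).

Definition clip_cmd :=
  Seq (clip_when test1) (Seq (clip_when test2)
  (Seq (clip_when test3) (clip_when test4))).

Definition cap_cmd :=
  Seq (Asg vw (Var vk))
  (Seq (If (Plus (Minus (Plus (src vp) (Cst 1)) (src vq))
                (Minus (Plus (dst vp) (Cst 1)) (dst vq)))
           (Asg vw (Cst 0)) Skip)
       (For vc vnc clip_cmd)).

Definition cap_table :=
  For vp vk (For vq vk (Seq cap_cmd (Put acap (idx vp vq) (Var vw)))).

Definition level0 :=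
  For vp vk (For vq vk
    (If (Plus (Minus (Var vp) (Var vq)) (Minus (Var vq) (Var vp)))
      (Put acur (idx vp vq) (Cst 0))
      (Seq (Put acur (idx vp vq) (Get apow (Var vp)))
           (Asg vbest (Get apow (Var vp)))))).

(** Again a sum of truncated subtractions, 0 iff all five conditions hold; the last two require both
    table cells to be nonzero. *)
Definition join_test :=
  Plus (Minus (Cst 5) (cell acap vrr vx))
  (Plus (Plus (Minus (Var vth) (cell acap vrr vq))
            (Minus (Var vth) (cell acap vp vx)))
       (Plus (Minus (Cst 1) (cell acur vp vrr)) (Minus (Cst 1) (cell acur vx vq)))).

Definition join_cmd :=
  For vrr vk (For vx vk
    (If join_test Skip
      (Asg vacc (Plus (cell acur vp vrr) (cell acur vx vq))))).

(** Only a nonzero mask replaces [vbest], so after all levels it describes a chain of the highest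
    nonempty level. *)
Definition next_table :=
  For vp vk (For vq vk
    (Seq (Asg vacc (Cst 0))
    (Seq join_cmd
    (Seq (Put anew (idx vp vq) (Var vacc))
         (If (Var vacc) (Asg vbest (Var vacc)) Skip))))).

Definition copy_table :=
  For vp vk (For vq vk (Put acur (idx vp vq) (cell anew vp vq))).

Definition level_cmd :=
  Seq (Asg vth (Plus (dbl (dbl (Var vh))) (Cst 1)))
  (Seq next_table (Seq copy_table (Asg vh (dbl (Var vh))))).

Definition levels := Seq (Asg vh (Cst 1)) (For vj vk level_cmd).

(** Bits are read from the highest down: bit [q] is set iff the remainder is at least [2 ^ q], which
    is then subtracted. *)
Definition decode_cmd :=
  For vp vk
    (Seq (Asg vq (Minus (Minus (Var vk) (Cst 1)) (Var vp)))
      (If (Minus (Get apow (Var vq)) (Var vbest))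
        (Put aio (Var vq) (Cst 0))
        (Seq (Put aio (Var vq) (Cst 1))
             (Asg vbest (Minus (Var vbest) (Get apow (Var vq))))))).

Definition main_cmd :=
  Seq prep (Seq cap_table (Seq level0 (Seq levels decode_cmd))).

(** The two loop bounds are loaded outside [main_cmd], which therefore never writes them and
    satisfies [okc]. *)
Definition dpsp_cmd :=
  Seq (Asg vk (Get aio (Cst 2)))
  (Seq (Asg vnc (Get aio (Plus (Cst 3) (dbl (Var vk))))) main_cmd).

Lemma wf_dpsp : wfc 0 dpsp_cmd.
Proof. by []. Qed.

Lemma ok_main : okc main_cmd.
Proof. by []. Qed.

(** * Correctness of the tables *)

Section Verification.

Variable I : dpsp_instance.
Let k := nb_demands I.
Let nc := size (constraints I).
Let dem i := nth (0, 0) (demands I) i.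
Let con i := nth (0, 0, 0, 0) (constraints I) i.
Let cap i j := capacity I (dem i) (dem j).

Definition input_ok s :=
  [/\ vr s vk = k, vr s vnc = nc,
    forall i, i < k -> ar s aio (3 + (i + i)) = (dem i).1
                    /\ ar s aio (4 + (i + i)) = (dem i).2
  & forall i, i < nc -> let at_ f := 4 + f + (k + k + (i + i + (i + i))) in
      [/\ ar s aio (at_ 0) = (con i).1.1.1, ar s aio (at_ 1) = (con i).1.1.2,
          ar s aio (at_ 2) = (con i).1.2 & ar s aio (at_ 3) = (con i).2]].

Definition tabs_ok s :=
  forall i, i < k -> ar s arow i = i * k /\ ar s apow i = 2 ^ i.

Lemma input_same V W st s : same V W st s ->
  [&& vk \notin V, vnc \notin V & aio \notin W] -> input_ok st -> input_ok s.
Proof.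
case=> sv sa /and3P [h0 h1 ha] [e0 e1 e2 e3]; split; rewrite ?sv //.
  by move=> i hi; rewrite !sa //; apply: e2.
by move=> i hi /=; rewrite !sa //; apply: e3.
Qed.

Lemma tabs_same V W st s : same V W st s ->
  (arow \notin W) && (apow \notin W) -> tabs_ok st -> tabs_ok s.
Proof.
by case=> sv sa /andP [h1 h2] h i hi; rewrite !sa //; apply: h.
Qed.

Lemma prep_ok st : vr st vk = k -> tabs_ok (run prep st).
Proof.
move=> ek; rewrite /prep 2!runSeq 2!runAsg; set s0 := setv _ vpw _.
have ek0 : vr s0 vk = k by [].
pose Inv j s := [/\ vr s vacc = j * k, vr s vpw = 2 ^ j
  & forall i, i < j -> ar s arow i = i * k /\ ar s apow i = 2 ^ i].
suff [] : Inv (vr s0 vk) (run (For vp vk prep_body) s0) by rewrite ek0.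
apply: For_ind => //.
move=> j s hj ej [sv _] [e1 e2 e3].
rewrite /prep_body 3!runSeq 2!runPut 2!runAsg /Inv /=.
have ek1 : vr s vk = k by rewrite sv.
split.
- by rewrite e1 ek1 mulSnr.
- by rewrite e2 expnS mul2n addnn.
move=> i; rewrite ltnS leq_eqVlt ej => /orP [/eqP ->|hi].
  by rewrite eqxx e1 e2.
have -> : i == j = false by lia.
exact: e3.
Qed.

Lemma clip_when_ok st s e w : same [:: vw] [::] st s -> vr s vw = w ->
  vw \notin rvars e ->
  same [:: vw] [::] st (run (clip_when e) s) /\
  vr (run (clip_when e) s) vw =
    if eval e st == 0 then minn w (eval (fld 3) st) else w.
Proof.
move=> sm ew he; split.
  exact: same_trans sm (run_same (clip_when e) s).
have ev : eval e s = eval e st.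
  apply: eval_same sm _ _; apply/allP => x // hx /=.
  by rewrite inE; apply: contra he => /eqP <-.
have ef : eval (fld 3) s = eval (fld 3) st by apply: eval_same sm _ _.
have em : eval (Minus (Var vw) (Minus (Var vw) (fld 3))) s =
  w - (w - eval (fld 3) s) by rewrite -ew.
rewrite /clip_when runIf runSkip runAsg ev em ef.
by move: (eval (fld 3) st) => wc; case: eqP => //= _; lia.
Qed.

Lemma clip_cmd_ok st p q c : input_ok st -> vr st vp = p -> vr st vq = q ->
  vr st vc = c -> p < k -> q < k -> c < nc ->
  vr (run clip_cmd st) vw = clip (dem p) (dem q) (vr st vw) (con c).
Proof.
case=> e0 e1 e2 e3 ep eq ec hp hq hc; rewrite !runSeq.
have sm0 : same [:: vw] [::] st st by [].
have [sm1 w1] := @clip_when_ok st st test1 _ sm0 erefl isT.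
have [sm2 w2] := @clip_when_ok st _ test2 _ sm1 w1 isT.
have [sm3 w3] := @clip_when_ok st _ test3 _ sm2 w2 isT.
have [sm4 w4] := @clip_when_ok st _ test4 _ sm3 w3 isT.
rewrite w4 {w4 w3 w2 w1 sm4 sm3 sm2 sm1 sm0} /=.
rewrite e0 ep eq ec.
have [f0 f1 f2 f3] := e3 _ hc; rewrite /= ?addn0 in f0 f1 f2 f3.
rewrite ?addn0 f0 f1 f2 f3.
have [-> ->] := e2 _ hp; have [-> ->] := e2 _ hq.
rewrite /clip; case: (con c) => [[[ty a] b] w] /=.
move: (vr st vw) (dem p) (dem q) => v [s t] [s' t'] /=; clear.
have tE n x y : ((ty - n + (n - ty) + (x + y)) == 0) = [&& ty == n, x == 0 & y == 0] by lia.
rewrite !tE !subn_eq0.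
(* Clipping by the same bound is idempotent, so the four tests combine to their disjunction. *)
have mm x : minn (minn x w) w = minn x w by rewrite -minnA minnn.
set b1 := [&& ty == 1, _ & _]; set b2 := [&& ty == 2, _ & _].
set b3 := [&& ty == 3, _ & _]; set b4 := [&& ty == 4, _ & _].
by case: b1; case: b2; case: b3; case: b4; rewrite /= ?mm.
Qed.

Lemma cap_cmd_ok st p q : input_ok st -> vr st vp = p -> vr st vq = q ->
  p < k -> q < k -> vr (run cap_cmd st) vw = cap p q.
Proof.
move=> inp ep eq hp hq; rewrite /cap_cmd 2!runSeq.
set s0 := run (Asg _ _) st; set s1 := run (If _ _ _) s0.
have sm0 : same [:: vw] [::] st s0 by exact: (run_same (Asg vw (Var vk)) st).
have sm1 : same [:: vw] [::] st s1.
  exact: same_trans sm0 (run_same (If _ (Asg vw (Cst 0)) Skip) s0).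
have ew1 : vr s1 vw = if ltp (dem p) (dem q) then k else 0.
  case: (inp) => e0 _ e2 _; have [f1 f2] := e2 _ hp; have [g1 g2] := e2 _ hq.
  rewrite /s1 runIf /s0 !runAsg runSkip /= ep eq f1 f2 g1 g2 /ltp.
  by case: ifP => /=; rewrite ?e0; case: ifP => //; lia.
have inp1 : input_ok s1 by apply: input_same sm1 _ inp.
have en : vr s1 vnc = nc by case: inp1.
pose Inv j s := vr s vw =
  foldl (clip (dem p) (dem q)) (vr s1 vw) (take j (constraints I)).
have : Inv (vr s1 vnc) (run (For vc vnc clip_cmd) s1).
  apply: For_ind => //; first by rewrite /Inv take0.
  move=> j s hj ej sm ew.
  have inps : input_ok s by apply: input_same sm _ inp1.
  rewrite en in hj; rewrite /Inv (take_nth (0, 0, 0, 0)) // foldl_rcons -ew.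
  apply: clip_cmd_ok => //.
  - by case: sm => sv _; rewrite sv //; case: sm1 => sv' _; rewrite sv'.
  - by case: sm => sv _; rewrite sv //; case: sm1 => sv' _; rewrite sv'.
by rewrite /Inv en take_size ew1.
Qed.

Definition done a c p q := (p < a) || ((p == a) && (q < c)).

Definition table A (T : nat -> nat -> nat -> Prop) a c s :=
  forall p q, p < k -> q < k -> done a c p q -> T p q (ar s A (p * k + q)).

Lemma table0 A T s : table A T 0 0 s.
Proof. by move=> p q _ _; rewrite /done; lia. Qed.

Lemma table_next A T a s : table A T a k s -> table A T a.+1 0 s.
Proof. by move=> h p q hp hq hd; apply: h => //; move: hd; rewrite /done; lia. Qed.

Lemma table_ext A T a c s s' : (forall y, ar s' A y = ar s A y) ->
  table A T a c s -> table A T a c s'.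
Proof. by move=> e h p q hp hq hd; rewrite e; apply: h. Qed.

Lemma cell_inj p q p' q' : q < k -> q' < k ->
  (p * k + q == p' * k + q') = (p == p') && (q == q').
Proof.
move=> hq hq'; apply/eqP/andP => [E|[/eqP -> /eqP ->]] //.
have k0 : 0 < k by apply: leq_ltn_trans hq.
have := congr1 (fun x => x %/ k) E; have := congr1 (fun x => x %% k) E.
rewrite /= !divnMDl // !modnMDl !modn_small // !divn_small // !addn0.
by move=> -> ->.
Qed.

Lemma table_put A (T : nat -> nat -> nat -> Prop) a c v s :
  a < k -> c < k -> T a c v -> table A T a c s ->
  table A T a c.+1 (seta s A (a * k + c) v).
Proof.
move=> ha hc hv h p q hp hq hd /=; rewrite eqxx cell_inj //.
case: eqP => [Ep|np] /=; last by apply: h => //; move: hd np; rewrite /done; lia.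
rewrite {p hp}Ep in hd *; case: eqP => [->|nq] //=.
by apply: h => //; move: hd nq; rewrite /done; lia.
Qed.

Lemma idxE s p q P Q : tabs_ok s -> vr s p = P -> vr s q = Q -> P < k ->
  eval (idx p q) s = P * k + Q.
Proof. by move=> tb /= -> -> hP; have [-> _] := tb _ hP. Qed.

Definition cap_ok s := table acap (fun p q v => v = cap p q) k 0 s.

Lemma table_full A T s p q : table A T k 0 s -> p < k -> q < k ->
  T p q (ar s A (p * k + q)).
Proof. by move=> h hp hq; apply: h; rewrite // /done hp. Qed.

Lemma cap_table_ok st : input_ok st -> tabs_ok st -> cap_ok (run cap_table st).
Proof.
move=> inp tb; have ek : vr st vk = k by case: inp.
have := @For2_ind (table acap (fun p q v => v = cap p q)) vp vq vk
  (Seq cap_cmd (Put acap (idx vp vq) (Var vw))) st isT.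
rewrite ek; apply=> //; first exact: table0.
  by move=> a s _; apply: table_next.
move=> a c s ha hc ea ec sm tab; rewrite runSeq runPut.
have inps : input_ok s by apply: input_same sm _ inp.
have tbs : tabs_ok s by apply: tabs_same sm _ tb.
have rs := run_same cap_cmd s.
have ec' := cap_cmd_ok inps ea ec ha hc.
have tb' : tabs_ok (run cap_cmd s) by apply: tabs_same rs _ tbs.
rewrite (@idxE _ _ _ a c) //; try by case: rs => -> //.
apply: table_put => //.
by apply: table_ext tab => y; case: rs => _ ->.
Qed.

(* A table cell stores a whole chain as a bit mask, [0] meaning that there is
   none; joining disjoint chains is an addition. *)
Definition code (l : seq nat) := \sum_(i <- l) 2 ^ i.

Definition entry j p q v :=
  (v = 0 /\ forall l, ~ good I j p q l) \/
  (exists2 l, good I j p q l & v = code l).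

(** For [j] equal to [k], the last clause is the hypothesis on levels in [opt_bound]. *)
Definition best_at j v := exists jb p q l,
  [/\ good I jb p q l, v = code l
    & forall j' p' q' l', j' <= j -> good I j' p' q' l' -> j' <= jb].

Lemma good_code_gt0 j p q l : good I j p q l -> 0 < code l.
Proof.
move=> g; have [pl _ _ _] := good_ends g.
by rewrite /code (big_rem _ pl) /= addn_gt0 expn_gt0.
Qed.

Lemma entry_gt0 j p q v : entry j p q v -> (0 < v) <-> (exists l, good I j p q l).
Proof.
case=> [[-> h]|[l g ->]]; split=> //.
- by case=> l /h.
- by exists l.
- by move=> _; apply: good_code_gt0 g.
Qed.

Lemma good_lt j p q l : good I j p q l -> p < k /\ q < k.
Proof.
move=> g; have [pl ql _ _] := good_ends g.
by have /allP h := good_bound g; rewrite /k !h.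
Qed.

Lemma level0_ok st : input_ok st -> tabs_ok st ->
  table acur (entry 0) k 0 (run level0 st) /\
  (0 < k -> best_at 0 (vr (run level0 st) vbest)).
Proof.
move=> inp tb; have ek : vr st vk = k by case: inp.
suff [h1 h2] : table acur (entry 0) k 0 (run level0 st) /\
    (0 < k \/ k < 0 -> exists2 p, p < k & vr (run level0 st) vbest = 2 ^ p).
  split=> // k0; have [|p hp ->] := h2; first by left.
  exists 0, p, p, [:: p]; split=> //.
  by rewrite /code big_seq1.
(* A diagonal cell has been visited iff [0 < a] or [a < c]; at the final position [(k, 0)] this
   reads [0 < k] or [k < 0]. *)
have := @For2_ind (fun a c s => table acur (entry 0) a c s /\
   (0 < a \/ a < c -> exists2 p, p < k & vr s vbest = 2 ^ p)) vp vq vk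
   (If (Plus (Minus (Var vp) (Var vq)) (Minus (Var vq) (Var vp)))
      (Put acur (idx vp vq) (Cst 0))
      (Seq (Put acur (idx vp vq) (Get apow (Var vp)))
           (Asg vbest (Get apow (Var vp))))) st isT.
rewrite ek; apply=> //.
- by split; [exact: table0|lia].
- by move=> a s ha [h1 h2]; split; [exact: table_next|move=> _; apply: h2; right].
move=> a c s ha hc ea ec sm [tab hb].
have tbs : tabs_ok s by apply: tabs_same sm _ tb.
rewrite runIf runSeq !runPut runAsg (@idxE _ _ _ a c) //.
rewrite [eval (Plus _ _) _]/= ea ec; case: eqP => E /=.
  have Eac : a = c by lia.
  split.
    apply: table_put => //; right; exists [:: a]; first by split.
    by rewrite /code big_seq1 ea; have [_ ->] := tbs _ ha.
  move=> _; exists a => //; rewrite /= ea; have [_ <-] := tbs _ ha.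
  by [].
split.
  apply: table_put => //; left; split=> // l [Eac _ _]; by lia.
by move=> h; apply: hb; lia.
Qed.

Definition joinable j p q r x :=
  [/\ exists l, good I j p r l, exists l, good I j x q l, 5 <= cap r x,
      4 * 2 ^ j + 1 <= cap r q & 4 * 2 ^ j + 1 <= cap p x].

Lemma join_cmd_ok st j p q : input_ok st -> tabs_ok st -> cap_ok st ->
  table acur (entry j) k 0 st -> vr st vth = 4 * 2 ^ j + 1 ->
  vr st vacc = 0 -> vr st vp = p -> vr st vq = q -> p < k -> q < k ->
  entry j.+1 p q (vr (run join_cmd st) vacc).
Proof.
move=> inp tb cp tab eth eacc ep eq hp hq; have ek : vr st vk = k by case: inp.
(* The loop keeps two facts: the accumulator is 0 or the mask of a chain, and it is nonzero once a
   joinable pair was visited. *)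
suff [h1 h2] : (vr (run join_cmd st) vacc = 0 \/
    exists2 l, good I j.+1 p q l & vr (run join_cmd st) vacc = code l) /\
   (forall r x, r < k -> x < k -> done k 0 r x -> joinable j p q r x ->
      vr (run join_cmd st) vacc != 0).
  case: h1 => [E|h1]; last by right.
  left; split=> // l [r [x [l1 [l2 [g1 g2 _ [c1 c2 c3]]]]]].
  have [_ hr] := good_lt g1; have [hx _] := good_lt g2.
  have dn : done k 0 r x by rewrite /done hr.
  have jn : joinable j p q r x by split=> //; [exists l1|exists l2].
  by have := h2 r x hr hx dn jn; rewrite E.
have := @For2_ind (fun a c s => (vr s vacc = 0 \/
    exists2 l, good I j.+1 p q l & vr s vacc = code l) /\
   (forall r x, r < k -> x < k -> done a c r x -> joinable j p q r x ->
      vr s vacc != 0)) vrr vx vk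
   (If join_test Skip
      (Asg vacc (Plus (cell acur vp vrr) (cell acur vx vq)))) st isT.
rewrite ek; apply=> //.
- by split; [left|move=> r x; rewrite /done; lia].
- move=> a s ha [h1 h2]; split=> // r x hr hx hd; apply: h2 => //.
  by move: hd; rewrite /done; lia.
move=> a c s ha hc ea ec sm [h1 h2].
have tbs : tabs_ok s by apply: tabs_same sm _ tb.
have [sv sa] := sm.
have ep' : vr s vp = p by rewrite sv.
have eq' : vr s vq = q by rewrite sv.
have eth' : vr s vth = 4 * 2 ^ j + 1 by rewrite sv.
have cellE A P Q u v : vr s P = u -> vr s Q = v -> u < k ->
    eval (cell A P Q) s = ar s A (u * k + v).
  by move=> e1 e2 hu; rewrite -(idxE tbs e1 e2 hu).
have capE u v : u < k -> v < k -> ar s acap (u * k + v) = cap u v.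
  by move=> hu hv; rewrite sa //; apply: (table_full cp).
have entE u v : u < k -> v < k -> entry j u v (ar s acur (u * k + v)).
  by move=> hu hv; rewrite sa //; apply: (table_full tab).
have c1 : eval (cell acap vrr vx) s = cap a c by rewrite (cellE _ _ _ a c) ?capE.
have c2 : eval (cell acap vrr vq) s = cap a q by rewrite (cellE _ _ _ a q) ?capE.
have c3 : eval (cell acap vp vx) s = cap p c by rewrite (cellE _ _ _ p c) ?capE.
have n1 : entry j p a (eval (cell acur vp vrr) s).
  by rewrite (cellE _ _ _ p a) //; apply: entE.
have n2 : entry j c q (eval (cell acur vx vq) s).
  by rewrite (cellE _ _ _ c q) //; apply: entE.
have tE : eval join_test s = (5 - cap a c) + ((4 * 2 ^ j + 1 - cap a q) +
    (4 * 2 ^ j + 1 - cap p c) + ((1 - eval (cell acur vp vrr) s) +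
    (1 - eval (cell acur vx vq) s))).
  by rewrite -c1 -c2 -c3 -eth'.
rewrite runIf runSkip runAsg.
have vE : eval (Plus (cell acur vp vrr) (cell acur vx vq)) s =
  eval (cell acur vp vrr) s + eval (cell acur vx vq) s by [].
rewrite vE tE.
move: (eval (cell acur vp vrr) s) (eval (cell acur vx vq) s) n1 n2 => v1 v2 n1 n2.
have tst : (5 - cap a c + (4 * 2 ^ j + 1 - cap a q + (4 * 2 ^ j + 1 - cap p c)
    + (1 - v1 + (1 - v2))) == 0) = [&& 5 <= cap a c, 4 * 2 ^ j + 1 <= cap a q,
    4 * 2 ^ j + 1 <= cap p c, 0 < v1 & 0 < v2].
  by move: (4 * 2 ^ j + 1) (cap a c) (cap a q) (cap p c); clear; lia.
rewrite tst; case: ifP => [/negP nt|/negbFE /and5P [t1 t2 t3 t4 t5]].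
  split=> // r x hr hx hd jn; have [|nd] := boolP (done a c r x).
    by move=> hd'; apply: h2 jn.
  have [Er Ex] : r = a /\ x = c by move: hd nd; rewrite /done; lia.
  case: nt; case: jn; rewrite Er Ex => g1 g2 -> -> ->.
  by rewrite (entry_gt0 n1).2 // (entry_gt0 n2).2.
split=> /=; last by move=> *; lia.
right; case: n1 => [[E1 _]|[l1 g1 ->]]; first by rewrite E1 in t4.
case: n2 => [[E2 _]|[l2 g2 ->]]; first by rewrite E2 in t5.
exists (l1 ++ l2); last by rewrite /code big_cat.
by exists a, c, l1, l2; split.
Qed.


Lemma next_table_ok st j : input_ok st -> tabs_ok st -> cap_ok st ->
  table acur (entry j) k 0 st -> vr st vth = 4 * 2 ^ j + 1 ->
  (0 < k -> best_at j (vr st vbest)) ->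
  table anew (entry j.+1) k 0 (run next_table st) /\
  (0 < k -> best_at j.+1 (vr (run next_table st) vbest)).
Proof.
move=> inp tb cp tab eth hb; have ek : vr st vk = k by case: inp.
(* Either [vbest] already holds a chain of the new level, or it is unchanged and all cells visited
   so far are empty. *)
pose Inv a c s := table anew (entry j.+1) a c s /\
  ((exists p q l, good I j.+1 p q l /\ vr s vbest = code l) \/
   (vr s vbest = vr st vbest /\ forall p q, p < k -> q < k -> done a c p q ->
      forall l, ~ good I j.+1 p q l)).
suff [h1 h2] : Inv (vr st vk) 0 (run next_table st).
  rewrite ek in h1 h2; split=> // k0.
  case: h2 => [[p [q [l [g e]]]]|[e h2]].
    by exists j.+1, p, q, l; split=> // j' *.
  have [jb [p [q [l [g e' mx]]]]] := hb k0.
  exists jb, p, q, l; split=> //; first by rewrite e.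
  move=> j' p' q' l'; rewrite leq_eqVlt => /orP [/eqP ->|hj]; last exact: mx.
  move=> g'; have [hp hq] := good_lt g'.
  by case: (h2 _ _ hp hq _ _ g'); rewrite /done hp.
apply: For2_ind => //.
- by split; [exact: table0|right; split=> // p q _ _; rewrite /done; lia].
- rewrite ek => a s _ [h1 h2]; split; first exact: table_next.
  case: h2 => [|[e h2]]; [by left|right; split=> // p q hp hq hd; apply: h2 => //].
  by move: hd; rewrite /done; lia.
rewrite ek => a c s ha hc ea ec sm [h1 h2].
rewrite 3!runSeq runAsg; set s0 := setv _ vacc _; set s1 := run join_cmd s0.
have sm0 : same [:: vacc] [::] s s0 by exact: (run_same (Asg vacc (Cst 0)) s).
have sm1 : same [:: vrr, vx & [:: vacc]] [::] s s1.
  have sj : same (wvars join_cmd) (warrs join_cmd) s0 s1 by apply: run_same.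
  apply: same_trans (same_sub _ _ sm0) (same_sub _ _ sj) => x //.
    by rewrite !inE => ->; rewrite !orbT.
  by rewrite /= !inE; lia.
have tbs : tabs_ok s by apply: tabs_same sm _ tb.
have en : entry j.+1 a c (vr s1 vacc).
  apply: join_cmd_ok => //.
  - by apply: input_same sm _ inp.
  - by apply: table_ext cp => y; case: sm => _ ->.
  - by apply: table_ext tab => y; case: sm => _ ->.
  - by rewrite -eth; case: sm => sv _; apply: sv.
have tb1 : tabs_ok s1 by apply: tabs_same sm1 _ tbs.
have [sv1 sa1] := sm1.
rewrite runPut (@idxE _ _ _ a c) ?sv1 // runIf runAsg runSkip.
have evE s' : eval (Var vacc) s' = vr s' vacc by [].
rewrite !evE -[vr (seta _ _ _ _) vacc]/(vr s1 vacc).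
have tab1 : table anew (entry j.+1) a c.+1 (seta s1 anew (a * k + c) (vr s1 vacc)).
  by apply: table_put => //; apply: table_ext h1 => y; rewrite sa1.
case: eqP => [E|/eqP NE] /=; split=> //.
  rewrite /= sv1 //; case: h2 => [|[e h2]]; first by left.
  right; split=> // p q hp hq hd; have [hd'|nd] := boolP (done a c p q).
    exact: h2.
  have [-> ->] : p = a /\ q = c by move: hd nd; rewrite /done; lia.
  case: en => [[]//|[l g e']].
  by have := good_code_gt0 g; rewrite -e' E.
left; case: en => [[e _]|[l g e]]; first by rewrite e in NE.
by exists a, c, l.
Qed.

Lemma copy_table_ok st T : input_ok st -> tabs_ok st ->
  table anew T k 0 st -> table acur T k 0 (run copy_table st).
Proof.
move=> inp tb tab; have ek : vr st vk = k by case: inp.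
suff : table acur T (vr st vk) 0 (run copy_table st) by rewrite ek.
apply: For2_ind => //; first exact: table0.
  by rewrite ek => a s _; apply: table_next.
rewrite ek => a c s ha hc ea ec sm h.
have tbs : tabs_ok s by apply: tabs_same sm _ tb.
rewrite runPut (@idxE _ _ _ a c) //; apply: table_put => //.
rewrite -[eval _ _]/(ar s anew (eval (idx vp vq) s)) (@idxE _ _ _ a c) //.
by case: sm => _ -> //; apply: table_full tab _ _.
Qed.

Lemma levels_ok st : input_ok st -> tabs_ok st -> cap_ok st ->
  table acur (entry 0) k 0 st -> (0 < k -> best_at 0 (vr st vbest)) ->
  0 < k -> best_at k (vr (run levels st) vbest).
Proof.
move=> inp tb cp tab hb k0; have ek : vr st vk = k by case: inp.
rewrite /levels runSeq runAsg; set s0 := setv _ _ _.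
have sm0 : same [:: vh] [::] st s0 by exact: (run_same (Asg vh (Cst 1)) st).
pose Inv j s := [/\ vr s vh = 2 ^ j, table acur (entry j) k 0 s
  & best_at j (vr s vbest)].
suff [_ _] : Inv (vr s0 vk) (run (For vj vk level_cmd) s0).
  by rewrite [vr s0 vk]ek.
apply: For_ind => //; first by split=> //; apply: hb.
move=> j s hj ej sm' [eh ts bs].
have sm : same (vj :: wvars level_cmd) (warrs level_cmd) st s.
  by apply: same_trans (same_sub _ _ sm0) sm' => x //; rewrite mem_seq1 => /eqP ->.
rewrite /level_cmd 3!runSeq 2!runAsg.
set s1 := setv s vth _; set s2 := run next_table s1; set s3 := run copy_table s2.
have inp1 : input_ok s1 by have := input_same sm isT inp.
have tb1 : tabs_ok s1 by apply: tabs_same sm _ tb.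
have cp1 : cap_ok s1 by apply: table_ext cp => y; case: sm => _ <-.
have eth1 : vr s1 vth = 4 * 2 ^ j + 1 by rewrite /= eh; lia.
have [t2 b2] := @next_table_ok s1 j inp1 tb1 cp1 ts eth1 (fun _ => bs).
have sm2 : same (wvars next_table) (warrs next_table) s1 s2 by apply: run_same.
have sm3 : same (wvars copy_table) (warrs copy_table) s2 s3 by apply: run_same.
have inp2 : input_ok s2 by apply: input_same sm2 _ inp1.
have tb2 : tabs_ok s2 by apply: tabs_same sm2 _ tb1.
have t3 := copy_table_ok inp2 tb2 t2.
split=> //.
- rewrite /=; case: sm3 => -> // _; case: sm2 => -> // _.
  by rewrite /= eh expnS mul2n addnn.
- by rewrite /=; case: sm3 => -> // _; apply: b2.
Qed.

(** * Decoding the bit mask *)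

Lemma code_lt_rec (l : seq nat) m : uniq l ->
  \sum_(i <- l | i < m.+1) 2 ^ i =
  \sum_(i <- l | i < m) 2 ^ i + (m \in l) * 2 ^ m.
Proof.
elim: l => [|x l IH] /=; first by rewrite !big_nil.
case/andP=> hx /IH e; rewrite !big_cons e in_cons ltnS.
have [E|ne] := eqVneq m x.
  by rewrite -E in hx *; rewrite leqnn ltnn (negbTE hx) mul0n mul1n addn0 addnC.
by rewrite leq_eqVlt eq_sym (negbTE ne) /=; case: ltnP => _; rewrite ?addnA.
Qed.

Lemma code_lt_bound (l : seq nat) m : uniq l -> \sum_(i <- l | i < m) 2 ^ i < 2 ^ m.
Proof.
move=> ul; elim: m => [|m IH]; first by rewrite big_pred0.
rewrite code_lt_rec // expnS; case: (m \in l); lia.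
Qed.

Lemma decode_ok st l : vr st vk = k -> tabs_ok st -> uniq l ->
  {in l, forall i, i < k} -> vr st vbest = code l ->
  forall i, i < k -> (ar (run decode_cmd st) aio i != 0) = (i \in l).
Proof.
move=> ek tb ul bl eb.
(* After [j] passes the remainder consists of the bits below [k - j], and all cells from there up
   are final. *)
pose Inv j s := vr s vbest = \sum_(i <- l | i < k - j) 2 ^ i /\
  forall i, k - j <= i < k -> (ar s aio i != 0) = (i \in l).
suff [_ h] : Inv (vr st vk) (run decode_cmd st).
  by move=> i hi; apply: h; rewrite ek subnn.
apply: For_ind => //.
  split; last by move=> i; lia.
  rewrite eb subn0 /code big_seq [RHS]big_seq_cond.
  by apply: eq_bigl => i; case: (boolP (i \in l)) => //= /bl ->.
rewrite ek => j s hj ej sm [e h].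
have tbs : tabs_ok s by apply: tabs_same sm _ tb.
have eks : vr s vk = k by case: sm => ->.
rewrite runSeq runIf runSeq !runPut !runAsg.
set m := k - 1 - j; have hm : m < k by rewrite /m; lia.
have Em : k - j = m.+1 by rewrite /m; lia.
rewrite Em in e h; rewrite code_lt_rec // in e.
have lt := code_lt_bound m ul.
have Em' : k - j.+1 = m by rewrite /m; lia.
have [_ pw] := tbs _ hm.
have e1 : eval (Minus (Minus (Var vk) (Cst 1)) (Var vp)) s = m by rewrite /= eks ej.
rewrite e1 /Inv Em' /= pw e.
have split_i i : m <= i < k -> i = m \/ i != m /\ m.+1 <= i < k by lia.
case hml : (m \in l); rewrite hml ?mul1n ?mul0n ?addn0 in e *; last first.
  (* Distinct powers below [2 ^ m] add up to less than [2 ^ m], so an absent bit is recognised. *)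
  have -> : 2 ^ m - \sum_(i <- l | i < m) 2 ^ i != 0.
    by rewrite -lt0n subn_gt0.
  split=> //= i /split_i [->|[ne hi]]; first by rewrite eqxx hml.
  by rewrite (negbTE ne); apply: h.
have -> : 2 ^ m - (\sum_(i <- l | i < m) 2 ^ i + 2 ^ m) != 0 = false.
  by apply/negbTE; rewrite negbK subn_eq0 leq_addl.
split=> /=; first by rewrite ?e ?pw addnK.
move=> i /split_i [->|[ne hi]]; first by rewrite eqxx hml.
by rewrite (negbTE ne); apply: h.
Qed.

Lemma main_ok st : input_ok st -> 0 < k ->
  exists jb p q l, [/\ good I jb p q l,
    forall i, i < k -> (ar (run main_cmd st) aio i != 0) = (i \in l)
    & forall j' p' q' l', j' <= k -> good I j' p' q' l' -> j' <= jb].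
Proof.
move=> inp k0; rewrite /main_cmd.
rewrite [run (Seq prep _) st]runSeq; set s1 := run prep st.
rewrite [run (Seq cap_table _) s1]runSeq; set s2 := run cap_table s1.
rewrite [run (Seq level0 _) s2]runSeq; set s3 := run level0 s2.
rewrite [run (Seq levels _) s3]runSeq; set s4 := run levels s3.
have ek : vr st vk = k by case: inp.
have tb1 : tabs_ok s1 by apply: prep_ok.
have sm1 : same (wvars prep) (warrs prep) st s1 by apply: run_same.
have sm2 : same (wvars cap_table) (warrs cap_table) s1 s2 by apply: run_same.
have sm3 : same (wvars level0) (warrs level0) s2 s3 by apply: run_same.
have sm4 : same (wvars levels) (warrs levels) s3 s4 by apply: run_same.
have inp1 : input_ok s1 by apply: input_same sm1 _ inp.
have cp2 : cap_ok s2 by apply: cap_table_ok.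
have inp2 : input_ok s2 by apply: input_same sm2 _ inp1.
have tb2 : tabs_ok s2 by apply: tabs_same sm2 _ tb1.
have [t3 b3] := level0_ok inp2 tb2.
have inp3 : input_ok s3 by apply: input_same sm3 _ inp2.
have tb3 : tabs_ok s3 by apply: tabs_same sm3 _ tb2.
have cp3 : cap_ok s3 by apply: table_ext cp2 => y; case: sm3 => _ ->.
have [jb [p [q [l [g e mx]]]]] := levels_ok inp3 tb3 cp3 t3 b3 k0.
have inp4 : input_ok s4 by apply: input_same sm4 _ inp3.
have tb4 : tabs_ok s4 by apply: tabs_same sm4 _ tb3.
exists jb, p, q, l; split=> //; apply: decode_ok => //.
- by case: inp4.
- exact: good_uniq g.
- by move=> i; apply: (allP (good_bound g)).
Qed.

End Verification.

(** * Layout of the encoded instance *)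

Lemma nth_flatten_pairs (s : seq (nat * nat)) r i : i < size s ->
  let w := flatten [seq [:: p.1; p.2] | p <- s] ++ r in
  nth 0 w (i + i) = (nth (0, 0) s i).1 /\
  nth 0 w (i + i).+1 = (nth (0, 0) s i).2.
Proof.
elim: s i => [|p s IH] [|i] // hi.
have -> : i.+1 + i.+1 = (i + i).+2 by lia.
exact: IH.
Qed.

Lemma size_flatten_pairs (s : seq (nat * nat)) :
  size (flatten [seq [:: p.1; p.2] | p <- s]) = size s + size s.
Proof. by elim: s => //= p s ->; rewrite addnS. Qed.

Definition enc_con (c : nat * nat * nat * nat) :=
  let: (ty, a, b, w) := c in [:: ty; a; b; w].

Lemma nth_flatten_cons (s : seq (nat * nat * nat * nat)) i : i < size s ->
  let w := flatten [seq enc_con c | c <- s] in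
  let c := nth (0, 0, 0, 0) s i in let j := i + i + (i + i) in
  [/\ nth 0 w j = c.1.1.1, nth 0 w j.+1 = c.1.1.2, nth 0 w j.+2 = c.1.2
    & nth 0 w j.+3 = c.2].
Proof.
elim: s i => [|[[[ty a] b] w] s IH] [|i] // hi.
have -> : i.+1 + i.+1 + (i.+1 + i.+1) = (i + i + (i + i)).+4 by lia.
exact: IH.
Qed.

Lemma size_flatten_cons (s : seq (nat * nat * nat * nat)) :
  size (flatten [seq enc_con c | c <- s]) = 4 * size s.
Proof. by elim: s => //= [[[[ty a] b] w] s] /= ->; lia. Qed.

Lemma nth_encode_ncons I :
  nth 0 (encode I) (3 + (nb_demands I + nb_demands I)) = size (constraints I).
Proof.
rewrite /encode nth_cat /= nth_cat size_flatten_pairs.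
by rewrite addKn /nb_demands ltnn subnn.
Qed.

Lemma size_encode I :
  size (encode I) = 4 + 2 * nb_demands I + 4 * size (constraints I).
Proof.
rewrite /encode -/enc_con !size_cat size_flatten_pairs size_flatten_cons /=.
by rewrite /nb_demands; lia.
Qed.

Lemma encode_heap_base I : size (encode I) <= heap_base (encode I).
Proof.
rewrite size_encode /heap_base.
have -> : nth 0 (encode I) 2 = nb_demands I by [].
have -> : 2 * nb_demands I + 3 = 3 + (nb_demands I + nb_demands I) by lia.
by rewrite nth_encode_ncons; lia.
Qed.

Lemma input_encode I st :
  (forall y, 1 < y -> ar st aio y = nth 0 (encode I) y) ->
  vr st vk = nb_demands I -> vr st vnc = size (constraints I) ->
  input_ok I st.
Proof.
move=> hst e0 e1; split=> // i hi.
  rewrite !hst //; exact: (@nth_flatten_pairs _ _ _ hi).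
have E f : nth 0 (encode I) (4 + f + (nb_demands I + nb_demands I + (i + i + (i + i))))
   = nth 0 (flatten [seq enc_con c | c <- constraints I]) (i + i + (i + i) + f).
  rewrite /encode -/enc_con nth_cat /= nth_cat size_flatten_pairs.
  rewrite -/(nb_demands I) ifF; last by lia.
  by rewrite -[_ :: _]cat1s nth_cat /= ifF; [congr nth|]; lia.
have [h0 h1 h2 h3] := nth_flatten_cons hi.
by rewrite /= !hst // !E; split; rewrite ?addn0 ?addn1 ?addn2 ?addn3.
Qed.

Theorem theorem3p3 :
  exists (P : program) (c d : nat),
    forall I : dpsp_instance, valid_instance I ->
      exists (T : nat) (M : memory),
        T <= c * (input_size I).+1 ^ d /\
        exec P T (0, init_mem (encode I)) = Some M /\
        feasible I (decode_sel M) /\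
        (forall sel : nat -> bool, feasible I sel ->
           sel_card I sel <= 8 * sel_card I (decode_sel M)).
Proof.
have [P [a HP]] := compile_correct wf_dpsp.
have [b [d Hb]] := bnd_poly main_cmd.
(* [a] pays for prologue and epilogue, 100 for the two header assignments, and [b] with degree [d]
   for the main program. *)
exists P, (a + 100 + b), d => I vI.
have [st0 [hin [T [M [hT hE hM]]]]] := HP _ (encode_heap_base I).
exists T, M.
set s2 := run (Asg 1 (Get 0 (Plus (Cst 3) (dbl (Var 0)))))
  (run (Asg 0 (Get 0 (Cst 2))) st0).
have e0 : vr s2 0 = nb_demands I by rewrite /s2 /run /= hin.
have e1 : vr s2 1 = size (constraints I).
  by rewrite -nth_encode_ncons -hin // -e0.
have inp : input_ok I s2 by apply: input_encode.
split; last split=> //.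
  apply: leq_trans hT _.
  (* [N] dominates both loop bounds and is at most [input_size I]. *)
  set N := nb_demands I + size (constraints I).
  have hc : cost dpsp_cmd st0 <= 100 + bnd main_cmd N.
    rewrite -[cost _ _]/(_ + (_ + cost main_cmd s2)) addnA leq_add //.
    by apply: cost_bnd; rewrite ?ok_main ?e0 ?e1 ?leq_addr ?leq_addl.
  have hN : N.+1 ^ d <= (input_size I).+1 ^ d.
    have [->|d0] := posnP d; first by rewrite !expn0.
    by rewrite leq_exp2r // ltnS /N /input_size; lia.
  have X0 : 0 < (input_size I).+1 ^ d by rewrite expn_gt0.
  have hb := leq_trans (Hb N) (leq_mul (leqnn b) hN).
  move: (cost _ _) (bnd _ _) (_ ^ d) X0 hc hb; clear => C B X X0 hc hb.
  have ha : a <= a * X by rewrite leq_pmulr.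
  by rewrite !mulnDl; move: (a * X) (b * X) ha hb hc X0; clear; lia.
have selE i : i < nb_demands I ->
    decode_sel M i = (ar (run main_cmd s2) 0 i != 0).
  move=> hi; rewrite /decode_sel hM //.
  have := encode_heap_base I; rewrite size_encode; lia.
(* Without demands there is no chain to decode, but every selection is empty and hence optimal. *)
have [k0|k0] := posnP (nb_demands I).
  have nil sel : sel_idx I sel = [::] by rewrite /sel_idx k0.
  split; last by move=> sel _; rewrite /sel_card nil.
  split; first by move=> i j; rewrite nil.
  by apply/allP => c _; apply: count_satisfies; rewrite nil.
have [jb [p [q [l [g hl mx]]]]] := main_ok inp k0.
have [fe ce] : feasible I (decode_sel M) /\ sel_card I (decode_sel M) = 2 ^ jb.
  by apply: good_feasible g _ => // i hi; rewrite selE ?hl.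
split=> // sel fs; rewrite ce.
by apply: opt_bound => // j p' q' l' hj; apply: mx.
Qed.
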